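(* Let $f:\mathbb{R}^I\to\mathbb{R}^I$ be sufficiently smooth, and consider the deferred correction (DeC) approach of order $d>1$ (with $M=d-1$ and $K=d$) for $y'=f(y)$, with operators $\mathcal{L}^1$ and $\mathcal{L}^2_{\gamma_n}$. Then the relaxed deferred correction (RDeC) procedure, with relaxation coefficient $\gamma_n$ given by $$\gamma_n=\frac{2\sum_{i,j=1}^s b_i a_{ij}\langle f_i,f_j\rangle}{\sum_{i,j=1}^s b_ib_j\langle f_i,f_j\rangle}\quad\text{if }\Big\|\sum_{i=1}^s b_if_i\Big\|^2\neq0,\qquad \gamma_n=1\ \text{ otherwise},$$ where $(a_{ij}),(b_i)$ are the Runge–Kutta coefficients of the DeC method and $f_i$ the corresponding stage derivatives, gives a numerical approximation with order of accuracy equal to $d$, where the relaxed value $y^{n+1}_{\gamma_n}$ is interpreted as an approximation of $y(t^n+\gamma_n\Delta t)$.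
   Context: Setting. The initial value problem is $y'(t)=f(y(t))$, $y(t_0)=y_0$, in $\mathbb{R}^I$ with inner product $\langle\cdot,\cdot\rangle$ and induced norm $\|\cdot\|$. For a step from $t^n$ with step size $\Delta t$, choose subtimesteps $t^n=t^0<t^1<\dots<t^M=t^n+\Delta t$ whose relative positions $(t^m-t^0)/\Delta t$ are fixed (independent of $n$ and $\Delta t$; for example equispaced or Gauss–Lobatto nodes). Let $\varphi_0,\dots,\varphi_M$ be the Lagrange polynomials of degree $M$ on these nodes, $\varphi_r(t^m)=\delta_{r,m}$, and set $$\theta_r^m:=\frac1{\Delta t}\int_{t^0}^{t^m}\varphi_r(s)\,\mathrm{d}s,\qquad \beta^m:=\frac{t^m-t^0}{t^M-t^0}.$$ For $\mathbf{y}=(y^0,\dots,y^M)$ with $y^0=y^n$ (the given numerical value at $t^n$), the operators have components, $m=1,\dots,M$, $$\mathcal{L}^{1,m}(\mathbf{y})=y^m-y^0-\beta^m\Delta t\,f(y^0),\qquad \mathcal{L}^{2,m}(\mathbf{y})=y^m-y^0-\Delta t\sum_{r=0}^M\theta_r^mf(y^r).$$ DeC algorithm of order $d$ ($K=d=M+1$): $y^{0,(k)}=y^n$ for all $k$; $y^{m,(0)}=y^n$ for $m=1,\dots,M$; for $k=1,\dots,K$, $\mathcal{L}^1(\mathbf{y}^{(k)})=\mathcal{L}^1(\mathbf{y}^{(k-1)})-\mathcal{L}^2(\mathbf{y}^{(k-1)})$; the DeC update is $y^{n+1}=y^{M,(K)}$. DeC as a Runge–Kutta method: the update is an explicit Runge–Kutta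 method $$u_i=y^n+\Delta t\sum_{j=1}^s a_{ij}f_j,\qquad f_i=f(u_i),\qquad y^{n+1}=y^n+\Delta t\sum_{j=1}^s b_jf_j,$$ with $s=(d-1)^2+1$ stages: the stage $y^n$, followed by the stages $y^{m,(k)}$, $m=1,\dots,M$, $k=1,\dots,K-1$ (blocks ordered by increasing $k$), where $$y^{m,(1)}=y^n+\Delta t\,\beta^mf(y^n),\qquad y^{m,(k)}=y^n+\Delta t\Big(\theta_0^mf(y^n)+\sum_{r=1}^M\theta_r^mf(y^{r,(k-1)})\Big)\quad(2\le k\le K-1),$$ $$y^{n+1}=y^n+\Delta t\Big(\theta_0^Mf(y^n)+\sum_{r=1}^M\theta_r^Mf(y^{r,(K-1)})\Big);$$ the coefficients $a_{ij}$, $b_j$ are read off from these formulas. RDeC procedure: in the DeC algorithm $\mathcal{L}^2$ is replaced by $\mathcal{L}^2_{\gamma_n}$, which coincides with $\mathcal{L}^2$ in the corrections $k=1,\dots,K-1$; in the last correction $k=K$ it coincides with $\mathcal{L}^2$ except that in the component $m=M$ the factor $\Delta t$ is multiplied by $\gamma_n$. Thus the relaxed update is $$y^{n+1}_{\gamma_n}=y^n+\gamma_n\Delta t\sum_{j=1}^sb_jf_j,$$ and it is taken as the numerical value at the new time $t^n+\gamma_n\Delta t$, from which the next step starts. ''Order of accuracy $d$'' has the usual meaning for one-step methods: on a bounded time interval on which the exact solution exists, the error between the numerical values and the exact solution at the corresponding (relaxed) times is $\mathcal{O}(\Delta t^d)$ as $\Delta t\to0$. *)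

(* Defs.v *)
From HB Require Import structures.
From mathcomp Require Import all_boot all_order all_algebra.
From mathcomp Require Import all_classical all_reals all_analysis.

Set Implicit Arguments.
Unset Strict Implicit.
Unset Printing Implicit Defensive.

Import Order.TTheory GRing.Theory Num.Theory.
Import numFieldNormedType.Exports.

Local Open Scope classical_set_scope.
Local Open Scope ring_scope.

(* C^k maps.  The domain is meant to be finite-dimensional, where continuity of
   x |-> 'd f x v for every fixed v is continuity of the differential. *)
Fixpoint of_class_C {R : realType} {V W : normedModType R} (k : nat)
    (f : V -> W) : Prop :=
  if k is k'.+1 then
    (forall x, differentiable f x) /\
    (forall v, of_class_C k' (fun x => 'd f x v))
  else continuous f.

Definition ode_solution {R : realType} {V : normedModType R} (f : V -> V)
    (t0 T : R) (y0 : V) (y : R -> V) : Prop :=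
  [/\ y t0 = y0,
      {within `[t0, T], continuous y} &
      forall t : R, t0 < t < T -> is_derive t 1 y (f (y t))].

Definition dot_norm {R : realType} {V : lmodType R} (dot : {dot V for idfun})
    (v : V) : R := Num.sqrt (dot v v).

(* Relative positions c m = (t^m - t^0) / dt of the subtimesteps; here and
   below, families indexed by m = 0, ..., M are functions on nat of which only
   the values at m <= M matter. *)
Definition subtimestep_positions {R : realType} (M : nat) (c : nat -> R) : Prop :=
  [/\ c 0%N = 0, c M = 1 & forall m, (m < M)%N -> c m < c m.+1].

Section RDeC.
Context {R : realType} {I : nat}.
Local Notation V := 'rV[R]_I.

Variables (dot : {dot V for idfun}) (d : nat) (c : nat -> R) (f : V -> V).
Local Notation M := (d.-1).
Local Notation K := d.

Section Step.
(* One step of size dt from the time tn and the value yn. *)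
Variables (dt tn : R) (yn : V).

Definition subtime (m : nat) : R := tn + c m * dt.

Definition lagrange_poly (r : nat) : {poly R} :=
  (lagrange M.+1 subtime)`_r.

Definition theta (r m : nat) : R :=
  dt^-1 * \int[lebesgue_measure]_(s in `[subtime 0, subtime m])
            (lagrange_poly r).[s].

Definition beta (m : nat) : R :=
  (subtime m - subtime 0) / (subtime M - subtime 0).

Definition L1 (y : nat -> V) (m : nat) : V :=
  y m - y 0%N - (beta m * dt) *: f (y 0%N).

Definition L2_scaled (g : R) (y : nat -> V) (m : nat) : V :=
  y m - y 0%N - (g * dt) *: \sum_(r < M.+1) theta r m *: f (y r).

Definition L2 : (nat -> V) -> nat -> V := L2_scaled 1.

(* The operator used in the correction k; only the final component of the last
   correction is relaxed. *)
Definition L2_relaxed (gamma : R) (k : nat) (y : nat -> V) (m : nat) : V :=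
  if (k == K) && (m == M) then L2_scaled gamma y m else L2 y m.

(* Y k m stands for y^{m,(k)}. *)
Definition rdec_corrections (gamma : R) (Y : nat -> nat -> V) : Prop :=
  [/\ forall k, (k <= K)%N -> Y k 0%N = yn,
      forall m, (1 <= m <= M)%N -> Y 0%N m = yn &
      forall k m, (1 <= k <= K)%N -> (1 <= m <= M)%N ->
        L1 (Y k) m = L1 (Y k.-1) m - L2_relaxed gamma k (Y k.-1) m].

(* Runge-Kutta form, with stages numbered from 0: stage 0 is yn and stage
   1 + (k - 1) * M + (m - 1) is y^{m,(k)}, for 1 <= m <= M, 1 <= k <= K - 1. *)
Definition nb_stages : nat := (M ^ 2 + 1)%N.
Definition stage_iter (i : nat) : nat := (i.-1 %/ M).+1.
Definition stage_node (i : nat) : nat := (i.-1 %% M).+1.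

Definition stage (Y : nat -> nat -> V) (i : nat) : V :=
  if i == 0%N then yn else Y (stage_iter i) (stage_node i).

Definition rk_a (i j : nat) : R :=
  if i == 0%N then 0
  else if j == 0%N then
    if stage_iter i == 1%N then beta (stage_node i)
    else theta 0 (stage_node i)
  else if stage_iter i == (stage_iter j).+1 then
    theta (stage_node j) (stage_node i)
  else 0.

Definition rk_b (j : nat) : R :=
  if j == 0%N then theta 0 M
  else if stage_iter j == K.-1 then theta (stage_node j) M
  else 0.

Definition relaxation_coeff (Y : nat -> nat -> V) : R :=
  let F i := f (stage Y i) in
  if dot_norm dot (\sum_(i < nb_stages) rk_b i *: F i) ^+ 2 != 0 then
    (2 * \sum_(i < nb_stages) \sum_(j < nb_stages)
           rk_b i * rk_a i j * dot (F i) (F j))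
    / (\sum_(i < nb_stages) \sum_(j < nb_stages)
           rk_b i * rk_b j * dot (F i) (F j))
  else 1.

Definition rdec_step (tn1 : R) (yn1 : V) : Prop :=
  exists Y : nat -> nat -> V,
    let gamma := relaxation_coeff Y in
    [/\ rdec_corrections gamma Y, tn1 = tn + gamma * dt & yn1 = Y K M].

End Step.

Definition rdec_solution (dt t0 : R) (y0 : V) (t : nat -> R) (y : nat -> V) :
    Prop :=
  [/\ t 0%N = t0, y 0%N = y0 &
      forall n, rdec_step dt (t n) (y n) (t n.+1) (y n.+1)].

End RDeC.

(* Main.v *)
(** Let P(s; x) be the degree-d Taylor polynomial in s of the local solution
    starting at x; its coefficients are iterated Lie derivatives along f.  Then
    P' - f(P) = O(s^d), the exact solution agrees with P up to O(s^(d+1)), and,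
    since P' has degree d - 1 = M, the quadrature formulas of L^2 are exact on
    it.  Each correction therefore gains one order:
    y^{m,(k)} = P(c_m dt; x) + O(dt^(k+1)).

    For the relaxation coefficient gamma = N / D, the difference dt^2 (D - N) is
    the defect of the same quadrature rule for d/ds |P(s; x) - x|^2, up to
    O(dt^(d+1)), so that gamma = 1 + O(dt^(d-1)) as long as |f|^2 stays away
    from 0.  This suffices: moving along the increment or along the flow for the
    extra time (gamma - 1) dt differs by O((gamma - 1) dt^2), hence the relaxed
    step is P(gamma dt; x) + O(dt^(d+1)), and a discrete Gronwall argument
    concludes.  By uniqueness f either never vanishes along the solution or
    vanishes identically on it; in the latter case the scheme is stationary. *)

Require Import Defs.
From HB Require Import structures.
From mathcomp Require Import all_boot all_order all_algebra.
From mathcomp Require Import all_classical all_reals all_analysis.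
From mathcomp Require Import ring lra zify.

Set Implicit Arguments.
Unset Strict Implicit.
Unset Printing Implicit Defensive.

Import Order.TTheory GRing.Theory Num.Theory.
Import numFieldNormedType.Exports.

Local Open Scope classical_set_scope.
Local Open Scope ring_scope.

(** * Maps of class C^k and mean value estimates *)

Section ClassC.
Context {R : realType} {V : normedModType R}.

(** P is a polynomial surrogate and not the flow itself: a solution is given through [y0] only, none
    through the numerical values. Inside a step everything is therefore compared with P, which makes
    sense for all x and s, relaxed times beyond dt included; the exact solution is compared with P
    only at points of its own trajectory. The obstacle is a circularity. The coefficient gamma is
    close to 1 where D is bounded below, D is bounded below near the exact solution, and staying
    near it is the claim. The convergence induction therefore carries the error bound itself, and
    the step restriction makes that bound small enough to keep the numerical values in a fixed ball
    where |f|^2 is at least half of its lower bound along the trajectory. Since relaxed steps vary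
    in length, error growth is measured by the elapsed time and not by the number of steps.
    Smoothness is counted on scalar functions, coordinate by coordinate: for f of class C^d, the Lie
    derivatives of a coordinate are C^1 up to order d, which makes P Lipschitz in x, and continuous
    at order d + 1, which bounds the Taylor remainder. *)

Lemma class_CS (W : normedModType R) k (f : V -> W) :
  of_class_C k.+1 f -> of_class_C k f.
Proof.
elim: k f => [|k IH] f [df cf]; first by move=> x; exact: differentiable_continuous.
by split=> // v; apply: IH; exact: cf.
Qed.

Lemma class_C_le (W : normedModType R) j k (f : V -> W) :
  (j <= k)%N -> of_class_C k f -> of_class_C j f.
Proof.
move=> /subnK <-; elim: (k - j)%N => // i IH; rewrite addSn => /class_CS; exact: IH.
Qed.

Lemma class_C_cst (W : normedModType R) k (a : W) : of_class_C k (fun _ : V => a).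
Proof.
elim: k a => [|k IH] a; first by move=> x; exact: cst_continuous.
split=> [x|v]; first exact: differentiable_cst.
by rewrite (_ : (fun x => _) = fun=> 0) //; apply/funext => x; rewrite diff_cst.
Qed.

Lemma class_CD (W : normedModType R) k (f g : V -> W) :
  of_class_C k f -> of_class_C k g -> of_class_C k (f + g).
Proof.
elim: k f g => [|k IH] f g.
  by move=> cf cg x; apply: continuousD; [exact: cf|exact: cg].
move=> [df cf] [dg cg]; split=> [x|v]; first exact: differentiableD.
rewrite (_ : (fun x => _) = (fun x => 'd f x v) + (fun x => 'd g x v)).
  by apply: IH; [exact: cf|exact: cg].
by apply/funext => x; rewrite diffD.
Qed.

Lemma class_CM k (f g : V -> R) :
  of_class_C k f -> of_class_C k g -> of_class_C k (f * g).
Proof.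
elim: k f g => [|k IH] f g.
  by move=> cf cg x; apply: continuousM; [exact: cf|exact: cg].
move=> /[dup] /class_CS cf0 [df cf] /[dup] /class_CS cg0 [dg cg].
split=> [x|v]; first exact: differentiableM.
rewrite (_ : (fun x => _) =
    f * (fun x => 'd g x v) + g * (fun x => 'd f x v)).
  by apply: class_CD; apply: IH => //; [exact: cg|exact: cf].
by apply/funext => x; rewrite diffM.
Qed.

Lemma class_C_sum (W : normedModType R) k n (f : 'I_n -> V -> W) :
  (forall i, of_class_C k (f i)) -> of_class_C k (\sum_(i < n) f i).
Proof.
move=> cf; elim/big_ind: _ => // [|u v]; [exact: class_C_cst|exact: class_CD].
Qed.

Lemma class_C_linear_comp (W U : normedModType R) (l : {linear W -> U}) k
  (f : V -> W) : continuous l -> of_class_C k f -> of_class_C k (l \o f).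
Proof.
move=> cl; elim: k f => [|k IH] f.
  by move=> cf x; apply: continuous_comp; [exact: cf|exact: cl].
move=> [df cf]; split=> [x|v].
  by apply: differentiable_comp => //; exact: linear_differentiable.
rewrite (_ : (fun x => _) = l \o (fun x => 'd f x v)); first by apply: IH; exact: cf.
apply/funext => x; rewrite diff_comp ?diff_lin //.
exact: linear_differentiable.
Qed.

End ClassC.

Section RowVectors.
Context {R : realType} {n : nat}.
Local Notation V := 'rV[R]_n.

Lemma row_norm_ge (v : V) i : `|v 0 i| <= `|v|.
Proof. by rewrite [leRHS]/Num.norm /= mx_normrE; apply/bigmax_geP; right; exists (ord0, i). Qed.

Lemma row_norm_le (v : V) B : 0 <= B -> (forall i, `|v 0 i| <= B) -> `|v| <= B.
Proof.
move=> B0 vB; rewrite [leLHS]/Num.norm /= mx_normrE; apply/bigmax_leP; split=> // -[i j] _ /=.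
by rewrite (ord1 i).
Qed.

Definition coordinate (i : 'I_n) (v : V) : R := v 0 i.

Fact coordinate_is_linear i : linear (coordinate i).
Proof. by move=> a u v; rewrite /coordinate !mxE. Qed.

HB.instance Definition _ i :=
  GRing.isLinear.Build R V R _ (coordinate i) (coordinate_is_linear i).

Lemma class_C_coord (W : normedModType R) k (f : W -> V) i :
  of_class_C k f -> of_class_C k (fun x => f x 0 i).
Proof. by apply: (class_C_linear_comp (l := coordinate i)); exact: coord_continuous. Qed.

Lemma diff_row (g : V -> R) x v :
  'd g x v = \sum_(i < n) v 0 i * 'd g x (delta_mx 0 i).
Proof. by rewrite [in LHS](row_sum_delta v) linear_sum; apply: eq_bigr => i _; rewrite linearZ. Qed.

Definition lie (f : V -> V) (g : V -> R) : V -> R := fun x => 'd g x (f x).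

(** [of_class_C] controls the differential in fixed directions only, whereas the direction [f x]
    moves with x. Expanding it in the standard basis leaves a finite sum of products of regular
    functions. *)
Lemma class_C_lie k f g : of_class_C k f -> of_class_C k.+1 g ->
  of_class_C k (lie f g).
Proof.
move=> cf [dg cg].
rewrite (_ : lie f g =
    \sum_(i < n) (fun x => f x 0 i) * (fun x => 'd g x (delta_mx 0 i))).
  by apply: class_C_sum => i; apply: class_CM; [exact: (class_C_coord i cf)|exact: cg].
apply/funext => x; rewrite fct_sumE.
exact: diff_row.
Qed.

(** One derivative fewer is asked of f than of g, because the first Lie derivative only multiplies
    by f. *)
Lemma class_C_iter_lie j k f g : of_class_C (j + k).-1 f -> of_class_C (j + k) g ->
  of_class_C k (iter j (lie f) g).
Proof.
elim: j g => [//|j IH] g cf cg; rewrite iterSr; apply: IH.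
  by apply: class_C_le cf; lia.
exact: class_C_lie cf cg.
Qed.

Lemma continuous_bounded_ball (W : normedModType R) (g : V -> W) rho :
  continuous g -> exists2 B : R, 0 <= B & forall x : V, `|x| <= rho -> `|g x| <= B.
Proof.
move=> cg; pose A := [set x : V | `|x| <= rho].
have cA : compact A.
  apply: bounded_closed_compact.
    by exists rho; split=> [|M rM x /le_trans]; [exact: num_real|apply; exact: ltW].
  rewrite (_ : A = (fun x : V => `|x|) @^-1` [set r | r <= rho]) //.
  by apply: closed_comp => // ? _; exact: norm_continuous.
have [B [_ gB]] : bounded_set (g @` A).
  by apply/compact_bounded/continuous_compact => //; exact: continuous_subspaceT.
exists (Num.max 0 (B + 1)); first by rewrite le_max lexx.
move=> x xr; rewrite le_max (gB (B + 1)) ?orbT ?ltrDl //; by exists x.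
Qed.

Lemma diff_bounded_ball (g : V -> R) rho : of_class_C 1 g ->
  exists2 L : R, 0 <= L & forall x v : V, `|x| <= rho -> `|'d g x v| <= L * `|v|.
Proof.
move=> [_ cg].
have /choice[B Bp] : forall i, exists B, 0 <= B /\
    forall x, `|x| <= rho -> `|'d g x (delta_mx 0 i : V)| <= B.
  by move=> i; have [B] := continuous_bounded_ball rho (cg (delta_mx 0 i)); exists B.
exists (\sum_i B i) => [|x v xr]; first by apply: sumr_ge0 => i _; have [] := Bp i.
rewrite diff_row (le_trans (ler_norm_sum _ _ _))// mulr_suml ler_sum// => i _.
have [B0 {}Bp] := Bp i.
by rewrite normrM mulrC ler_pM// ?Bp// row_norm_ge.
Qed.

Lemma is_derive_comp_curve (g : V -> R) (z : R -> V) (t : R) v :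
  is_derive t (1 : R) z v -> differentiable g (z t) ->
  is_derive t (1 : R) (g \o z) ('d g (z t) v).
Proof.
move=> dz dg; have /derivable1_diffP dz' := @ex_derive _ _ _ _ _ _ _ dz.
have dgz : differentiable (g \o z) t by exact: differentiable_comp.
apply: DeriveDef; first exact: diff_derivable.
rewrite deriveE // diff_comp //=; congr ('d g _ _).
by rewrite -deriveE // derive_val.
Qed.

Lemma mean_value_bound (u u' : R -> R) (h B : R) : 0 <= h ->
  {within `[0, h], continuous u} ->
  (forall s : R, 0 < s < h -> is_derive s 1 u (u' s)) ->
  (forall s : R, 0 < s < h -> `|u' s| <= B) -> `|u h - u 0| <= B * h.
Proof.
move=> h0 cu du uB; move: h0; rewrite le_eqVlt => /predU1P[<-|h0].
  by rewrite subrr normr0 mulr0.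
have {}du s : s \in `]0, h[ -> is_derive s 1 u (u' s) by rewrite in_itv; exact: du.
have [s sh ->] := MVT h0 du cu.
by rewrite subr0 normrM (gtr0_norm h0) ler_pM2r// uB//; move: sh; rewrite in_itv.
Qed.

Lemma class_C1_lipschitz (g : V -> R) rho : of_class_C 1 g ->
  exists2 L : R, 0 <= L & forall x y : V, `|x| <= rho -> `|y| <= rho ->
    `|g x - g y| <= L * `|x - y|.
Proof.
move=> cg; have [L L0 Lp] := diff_bounded_ball rho cg.
exists L => // x y xr yr; pose z (s : R) := y + s *: (x - y).
have dz (s : R) : is_derive s (1 : R) z (x - y).
  have d1 : is_derive s (1 : R) ( *:%R^~ (x - y)) (x - y).
    apply: DeriveDef; first by apply/derivable1_diffP.
    by rewrite deriveE // diff_val scale1r.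
  by have := is_deriveD (is_derive_cst y s (1 : R)) d1; rewrite add0r.
have zr (s : R) : 0 < s < 1 -> `|z s| <= rho.
  move=> /andP[s0 s1]; rewrite (_ : z s = (1 - s) *: y + s *: x); last first.
    by rewrite /z scalerBr scalerBl scale1r addrA addrAC.
  rewrite (le_trans (ler_normD _ _))// !normrZ (gtr0_norm s0) gtr0_norm; last by lra.
  by nra.
have [dg _] := cg.
have dgz s := is_derive_comp_curve (dz s) (dg _).
have := @mean_value_bound (g \o z) _ 1 (L * `|x - y|) ler01 _ (fun s _ => dgz s) _.
rewrite /= /z scale1r scale0r addr0 subrKC mulr1; apply.
  apply: continuous_subspaceT => s; apply: differentiable_continuous.
  by apply/derivable1_diffP; have [] := dgz s.
by move=> s s1; rewrite Lp ?zr.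
Qed.

End RowVectors.


(** * Taylor expansion along the vector field *)

Section LieTaylor.
Context {R : realType} {n : nat}.
Local Notation V := 'rV[R]_n.
Implicit Types (f : V -> V) (g : V -> R) (x : V).

(** Taylor polynomial at 0 of g along the solution of z' = f(z) starting at x; k counts the terms,
    so the degree is below k. *)
Definition lie_poly f g k x : {poly R} :=
  \poly_(i < k) (iter i (lie f) g x / i`!%:R).

(** Differentiating in time amounts to passing from g to [lie f g] with one term fewer; the Taylor
    estimates below are inductions driven by this identity. *)
Lemma deriv_lie_poly f g k x :
  (lie_poly f g k.+1 x)^`() = lie_poly f (lie f g) k x.
Proof.
apply/polyP => i; rewrite coef_deriv !coef_poly ltnS.
case: ifP => _; last by rewrite mul0rn.
rewrite -iterSr factS natrM invfM -[LHS]mulr_natr [_^-1 * _]mulrC mulrA.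
by rewrite divfK // pnatr_eq0.
Qed.

Lemma lie_poly0 f g k x : (lie_poly f g k.+1 x).[0] = g x.
Proof. by rewrite horner_coef0 coef_poly /= fact0 divr1. Qed.

(* Applied both to the exact solution (B = 0) and, inductively, to the Taylor
   polynomial of the flow, whose defect z' - f(z) is only O(s^(k-1)). *)
Lemma lie_taylor f rho B k g : 0 <= B -> of_class_C k.-1 f -> of_class_C k g ->
  exists2 C : R, 0 <= C & forall (h : R) (z z' : R -> V), 0 <= h <= 1 ->
    {within `[0, h], continuous z} ->
    (forall s : R, 0 < s < h -> is_derive s (1 : R) z (z' s)) ->
    (forall s : R, 0 <= s <= h -> `|z s| <= rho) ->
    (forall s : R, 0 < s < h -> `|z' s - f (z s)| <= B * s ^+ k.-1) ->
    `|g (z h) - (lie_poly f g k (z 0)).[h]| <= C * h ^+ k.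
Proof.
move=> B0; elim: k g => [|k IH] g cf cg.
  have [C C0 gC] := continuous_bounded_ball rho cg.
  exists C => // h z z' /andP[h0 _] _ _ zr _.
  by rewrite /lie_poly poly_def big_ord0 horner0 subr0 mulr1 gC// zr// lexx h0.
have clg : of_class_C k (lie f g) by exact: class_C_lie.
have [C C0 IHC] := IH _ (class_C_le (leq_pred k) cf) clg.
have cg1 : of_class_C 1 g by exact: class_C_le cg.
have [L L0 dgL] := diff_bounded_ball rho cg1.
exists (C + L * B) => [|h z z' /andP[h0 h1] cz dz zr zB].
  by rewrite addr_ge0 ?mulr_ge0.
have dg : forall x, differentiable g x by case: cg.
pose q := lie_poly f g k.+1 (z 0).
pose u s := g (z s) - q.[s].
have -> : g (z h) - q.[h] = u h - u 0 by rewrite /u lie_poly0 subrr subr0.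
rewrite exprSr mulrA.
apply: (@mean_value_bound _ u (fun s => 'd g (z s) (z' s) - q^`().[s])) => //.
- move=> s; apply: (@continuousB _ R^o (subspace `[0, h]) (g \o z) (horner q)).
    apply: continuous_comp; first exact: cz.
    exact/differentiable_continuous/dg.
  by apply: continuous_subspaceT; exact: continuous_horner.
- move=> s sh; apply: is_deriveB; first exact/is_derive_comp_curve/dg/dz.
move=> s /[dup] sh /andP[s0 s_h].
have s01 : 0 <= s <= 1 by rewrite !ltW//= (lt_le_trans s_h).
have s_sub : `[0, s] `<=` `[0, h].
  by move=> t /=; rewrite !in_itv /= => /andP[-> /le_trans]; apply; exact: ltW.
have Hs : `|lie f g (z s) - q^`().[s]| <= C * s ^+ k.
  rewrite /q deriv_lie_poly; apply: (IHC s z z') => //.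
  - exact: continuous_subspaceW cz.
  - by move=> t /andP[t0 ts]; apply: dz; rewrite t0 (lt_trans ts).
  - by move=> t /andP[t0 ts]; apply: zr; rewrite t0 (le_trans ts)// ltW.
  (* The defect bound is weakened from t^k to t^(k-1), which requires t <= 1; hence the restriction
     to h <= 1. *)
  - move=> t /andP[t0 ts]; apply: (le_trans (zB t _)); first by rewrite t0 (lt_trans ts).
    rewrite ler_wpM2l// ler_wiXn2l// ?leq_pred// ?ltW//.
    by rewrite (lt_trans ts)// (lt_le_trans s_h).
(* The derivative of [u] is the remainder of [lie f g] at time s, bounded by the induction
   hypothesis on [0, s], plus the differential of g applied to the defect of z. *)
have -> : 'd g (z s) (z' s) - q^`().[s] =
    (lie f g (z s) - q^`().[s]) + 'd g (z s) (z' s - f (z s)).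
  by rewrite /lie linearB /= [RHS]addrC addrA subrK.
rewrite (le_trans (ler_normD _ _))// mulrDl.
apply: (@le_trans _ _ (C * s ^+ k + L * B * s ^+ k)); last first.
  rewrite -!mulrDl ler_wpM2l ?addr_ge0 ?mulr_ge0//.
  by apply: lerXn2r; rewrite ?nnegrE// ltW.
rewrite lerD//; apply: (le_trans (dgL _ _ _)).
  by apply: zr; rewrite !ltW.
by rewrite -mulrA ler_wpM2l// zB.
Qed.

Lemma lie_poly_bound f g k rho :
  of_class_C k.-1 f -> of_class_C k g ->
  exists2 B : R, 0 <= B & forall x i, `|x| <= rho -> `|(lie_poly f g k.+1 x)`_i| <= B.
Proof.
move=> cf cg; have /choice[B Bp] : forall i : 'I_k.+1, exists B, 0 <= B /\
    forall x, `|x| <= rho -> `|iter i (lie f) g x / i`!%:R| <= B.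
  move=> i; have ik : (i <= k)%N by rewrite -ltnS.
  have cig : of_class_C 0 (iter i (lie f) g).
    apply: class_C_iter_lie; [apply: class_C_le cf|apply: class_C_le cg]; lia.
  have [B B0 gB] := continuous_bounded_ball rho cig.
  exists (B * `|i`!%:R^-1|); split=> [|x xr]; first by rewrite mulr_ge0.
  by rewrite normrM ler_wpM2r// gB.
exists (\sum_i B i) => [|x i xr]; first by apply: sumr_ge0 => i _; have [] := Bp i.
rewrite coef_poly; case: ifPn => [ik|_]; last first.
  by rewrite normr0; apply: sumr_ge0 => j _; have [] := Bp j.
have [_ /(_ x xr)/= Bi] := Bp (Ordinal ik).
rewrite (le_trans Bi)// (bigD1 (Ordinal ik))//= lerDl.
by apply: sumr_ge0 => j _; have [] := Bp j.
Qed.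

Lemma lie_poly_trunc f g j k rho : (j <= k)%N ->
  of_class_C k f -> of_class_C k g ->
  exists2 C : R, 0 <= C & forall x (s : R), `|x| <= rho -> 0 <= s <= 1 ->
    `|(lie_poly f g k x).[s] - (lie_poly f g j x).[s]| <= C * s ^+ j.
Proof.
move=> jk cf cg; have [B B0 gB] := lie_poly_bound rho (class_C_le (leq_pred k) cf) cg.
exists (B * (k - j)%:R) => [|x s xr /andP[s0 s1]]; first by rewrite mulr_ge0.
rewrite !horner_poly -!(big_mkord xpredT (fun i => iter i (lie f) g x / i`!%:R * s ^+ i)).
rewrite (big_cat_nat _ jk)//= [X in `|X|]addrC addKr.
rewrite (le_trans (ler_norm_sum _ _ _))// mulrAC mulr_natr -sumr_const_nat.
rewrite big_nat_cond [leRHS]big_nat_cond ler_sum// => i /andP[/andP[ji ik] _].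
rewrite normrM ler_pM//; last by rewrite normrX ger0_norm// ler_wiXn2l.
by have := gB x i xr; rewrite coef_poly ltnS ltnW.
Qed.

End LieTaylor.


(** * Big-O estimates uniform over a set of parameters *)

Section BigO.
Context {R : realType} {S : Type}.
Implicit Types (W : normedModType R) (A : set S) (w : S -> R).

(** A single constant for all of A instead of a limit: the estimates must be uniform in the starting
    point and in the correction iterates, not only asymptotic in dt. *)
Definition dominated_on W A w (u : S -> W) :=
  exists2 C : R, 0 <= C & forall s, A s -> `|u s| <= C * w s.

Lemma dominated_weaken W A A' w w' (u : S -> W) (K : R) :
  A `<=` A' -> 0 <= K -> (forall s, A s -> w' s <= K * w s) ->
  dominated_on A' w' u -> dominated_on A w u.
Proof.
move=> AA' K0 ww' [C C0 uC]; exists (C * K) => [|s As]; first exact: mulr_ge0.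
by rewrite (le_trans (uC s (AA' _ As)))// -mulrA ler_wpM2l// ww'.
Qed.

Lemma eq_dominated W A w (u v : S -> W) : (forall s, A s -> u s = v s) ->
  dominated_on A w u -> dominated_on A w v.
Proof. by move=> uv [C C0 uC]; exists C => // s As; rewrite -uv// uC. Qed.

Lemma dominated0 W A w : (forall s, A s -> 0 <= w s) -> dominated_on A w (fun=> 0 : W).
Proof. by move=> w0; exists 0 => // s As; rewrite normr0 mul0r. Qed.

Lemma dominatedD W A w (u v : S -> W) :
  dominated_on A w u -> dominated_on A w v -> dominated_on A w (fun s => u s + v s).
Proof.
move=> [C C0 uC] [D D0 vD]; exists (C + D) => [|s As]; first exact: addr_ge0.
by rewrite mulrDl (le_trans (ler_normD _ _))// lerD ?uC ?vD.
Qed.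

Lemma dominatedN W A w (u : S -> W) : dominated_on A w u -> dominated_on A w (fun s => - u s).
Proof. by move=> [C C0 uC]; exists C => // s As; rewrite normrN uC. Qed.

Lemma dominatedB W A w (u v : S -> W) :
  dominated_on A w u -> dominated_on A w v -> dominated_on A w (fun s => u s - v s).
Proof. by move=> Ou Ov; apply: dominatedD => //; exact: dominatedN. Qed.

Lemma dominated_sum W A w n (u : 'I_n -> S -> W) : (forall s, A s -> 0 <= w s) ->
  (forall i, dominated_on A w (u i)) -> dominated_on A w (fun s => \sum_(i < n) u i s).
Proof.
move=> w0 Ou; rewrite (_ : (fun s => _) = \sum_(i < n) u i); last first.
  by apply/funext => s; rewrite fct_sumE.
by elim/big_ind: _ => //; [exact: dominated0|move=> *; exact: dominatedD].
Qed.

Lemma dominatedZ W A w w' (a : S -> R) (u : S -> W) :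
  dominated_on A w a -> dominated_on A w' u ->
  dominated_on A (fun s => w s * w' s) (fun s => a s *: u s).
Proof.
move=> [C C0 uC] [D D0 vD]; exists (C * D) => [|s As]; first exact: mulr_ge0.
by rewrite normrZ mulrACA ler_pM ?uC ?vD.
Qed.

Lemma dominated_cstZ W A w a (u : S -> W) :
  dominated_on A w u -> dominated_on A w (fun s => a *: u s).
Proof.
move=> [C C0 uC]; exists (`|a| * C) => [|s As]; first exact: mulr_ge0.
by rewrite normrZ -mulrA ler_wpM2l// uC.
Qed.

Lemma dominated_row n A w (u : S -> 'rV[R]_n) : (forall s, A s -> 0 <= w s) ->
  (forall i, dominated_on A w (fun s => u s 0 i)) -> dominated_on A w u.
Proof.
move=> w0 Ou; have /choice[C Cp] : forall i, exists C : R, 0 <= C /\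
    forall s, A s -> `|u s 0 i| <= C * w s.
  by move=> i; have [C] := Ou i; exists C.
exists (\sum_i C i) => [|s As]; first by apply: sumr_ge0 => i _; have [] := Cp i.
have sC : forall P : pred 'I_n, 0 <= \sum_(i | P i) C i.
  by move=> P; apply: sumr_ge0 => i _; have [] := Cp i.
apply: row_norm_le => [|i]; first by rewrite mulr_ge0// w0.
have [C0 /(_ s As) /le_trans] := Cp i; apply.
by rewrite ler_wpM2r// ?w0// (bigD1 i)//= lerDl.
Qed.

Lemma dominated_lt W A w (u : S -> W) (e : R) : 0 < e -> dominated_on A w u ->
  exists2 del : R, 0 < del & forall s, A s -> w s <= del -> `|u s| <= e.
Proof.
move=> e0 [C C0 uC]; have C1 : 0 < C + 1 by rewrite ltr_wpDl.
exists (e / (C + 1)) => [|s As wd]; first by rewrite divr_gt0.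
rewrite (le_trans (uC s As))// (@le_trans _ _ (C * (e / (C + 1))))//.
  by rewrite ler_wpM2l.
by rewrite mulrCA ler_piMr ?(ltW e0)// ler_pdivrMr// mul1r lerDl.
Qed.

End BigO.

Lemma dominated_comp {R : realType} {S T : Type} (W : normedModType R) (A : set S) (B : set T)
  w (u : S -> W) (phi : T -> S) : (forall t, B t -> A (phi t)) ->
  dominated_on A w u -> dominated_on B (w \o phi) (u \o phi).
Proof. by move=> BA [C C0 uC]; exists C => // t /BA; exact: uC. Qed.

(** * The Taylor polynomial P of the flow and its defect *)

Section LieFlow.
Context {R : realType} {n : nat}.
Local Notation V := 'rV[R]_n.
Variables (f : V -> V) (d : nat).
Hypothesis cf : of_class_C d f.

Lemma class_C_linear (l : {linear V -> R}) k : continuous l -> of_class_C k l.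
Proof.
move=> cl; case: k => [//|k]; split=> [x|v]; first exact: linear_differentiable.
rewrite (_ : (fun x => _) = fun=> l v); first exact: class_C_cst.
by apply/funext => x; rewrite diff_lin.
Qed.

Lemma class_C_coordinate k (m : 'I_n) : of_class_C k (@coordinate R n m).
Proof. by apply: class_C_linear; exact: coord_continuous. Qed.

Lemma lie_coordinate m x : lie f (coordinate m) x = f x 0 m.
Proof. by rewrite /lie diff_lin //; exact: coord_continuous. Qed.

Definition flow_coef i x : V := \row_m (iter i (lie f) (coordinate m) x / i`!%:R).

Definition lie_flow x (s : R) : V := \sum_(i < d.+1) s ^+ i *: flow_coef i x.

Definition lie_flow' x (s : R) : V :=
  \sum_(i < d) (i.+1%:R * s ^+ i) *: flow_coef i.+1 x.

Lemma flow_coef0 x : flow_coef 0 x = x.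
Proof. by apply/rowP => m; rewrite mxE fact0 divr1. Qed.

Lemma flow_coef1 x : flow_coef 1 x = f x.
Proof. by apply/rowP => m; rewrite mxE /= divr1 lie_coordinate. Qed.

Lemma lie_flow0 x : lie_flow x 0 = x.
Proof.
rewrite /lie_flow big_ord_recl expr0 scale1r flow_coef0 big1 ?addr0// => i _.
by rewrite expr0n scale0r.
Qed.

Lemma lie_flow_coord x s m :
  lie_flow x s 0 m = (lie_poly f (coordinate m) d.+1 x).[s].
Proof.
rewrite /lie_flow summxE horner_poly; apply: eq_bigr => i _.
by rewrite !mxE mulrC.
Qed.

Lemma lie_flow'_coord x s m :
  lie_flow' x s 0 m = (lie_poly f (coordinate m) d.+1 x)^`().[s].
Proof.
rewrite deriv_lie_poly /lie_flow' summxE horner_poly; apply: eq_bigr => i _.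
rewrite !mxE -iterSr factS natrM.
have a0 : i.+1%:R != 0 :> R by rewrite pnatr_eq0.
have b0 : i`!%:R != 0 :> R by rewrite pnatr_eq0 -lt0n fact_gt0.
move: (i.+1%:R : R) (i`!%:R : R) a0 b0 => a b a0 b0.
by field; rewrite a0 b0.
Qed.

Lemma is_derive_lie_flow x (s : R) : is_derive s (1 : R) (lie_flow x) (lie_flow' x s).
Proof.
apply: DeriveDef.
  apply/derivable_mxP => i j; rewrite (ord1 i).
  rewrite (_ : (fun s => _) = horner (lie_poly f (coordinate j) d.+1 x)).
    exact: derivable_horner.
  by apply/funext => t; rewrite lie_flow_coord.
rewrite derive_mx; last first.
  apply/derivable_mxP => i j; rewrite (ord1 i).
  rewrite (_ : (fun s => _) = horner (lie_poly f (coordinate j) d.+1 x)).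
    exact: derivable_horner.
  by apply/funext => t; rewrite lie_flow_coord.
apply/rowP => m; rewrite mxE lie_flow'_coord.
rewrite (_ : (fun s => _) = horner (lie_poly f (coordinate m) d.+1 x)).
  by rewrite derive_val.
by apply/funext => t; rewrite lie_flow_coord.
Qed.

Lemma continuous_lie_flow x : continuous (lie_flow x).
Proof.
move=> s; apply: differentiable_continuous; apply/derivable1_diffP.
by have [] := is_derive_lie_flow x s.
Qed.

Lemma flow_coef_bounded i rho : (i <= d)%N ->
  dominated_on [set x | `|x| <= rho] (fun=> 1) (flow_coef i).
Proof.
move=> id; apply: dominated_row => // m.
have ci : of_class_C 0 (iter i (lie f) (coordinate m)).
  apply: class_C_iter_lie; last exact: class_C_coordinate.
  by apply: class_C_le cf; lia.
have [B B0 gB] := continuous_bounded_ball rho ci.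
exists (B * `|i`!%:R^-1|) => [|x xr]; first by rewrite mulr_ge0.
by rewrite mxE normrM mulr1 ler_wpM2r// gB.
Qed.

Lemma flow_coef_lipschitz i rho : (i <= d)%N ->
  dominated_on [set p : V * V | `|p.1| <= rho /\ `|p.2| <= rho] (fun p => `|p.1 - p.2|)
    (fun p => flow_coef i p.1 - flow_coef i p.2).
Proof.
move=> id; apply: dominated_row => // m.
have ci : of_class_C 1 (iter i (lie f) (coordinate m)).
  apply: class_C_iter_lie; last exact: class_C_coordinate.
  by apply: class_C_le cf; lia.
have [B B0 gB] := class_C1_lipschitz rho ci.
exists (`|i`!%:R^-1| * B) => [|[x x'] [/= xr xr']]; first by rewrite mulr_ge0.
by rewrite !mxE -mulrBl normrM mulrC -mulrA ler_wpM2l// gB.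
Qed.

(** Bootstrap on the order j. If the defect is O(s^j), then [lie_taylor] expands f(P) up to
    O(s^(j+1)) as the Taylor polynomial with j + 1 terms of [lie f] of a coordinate. P' is the
    polynomial of that same function with d terms, and the extra terms are O(s^(j+1)) too. The
    second radius keeps the whole arc of P in the ball where [lie_taylor] is applied. *)
Lemma lie_flow_defect rho rho' :
  dominated_on [set p : V * R | [/\ `|p.1| <= rho, 0 <= p.2 <= 1 &
      forall t, 0 <= t <= p.2 -> `|lie_flow p.1 t| <= rho']]
    (fun p => p.2 ^+ d)
    (fun p => lie_flow' p.1 p.2 - f (lie_flow p.1 p.2)).
Proof.
set A := [set p | _]; suff : forall j, (j <= d)%N -> dominated_on A (fun p => p.2 ^+ j)
    (fun p => lie_flow' p.1 p.2 - f (lie_flow p.1 p.2)) by apply.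
have A0 j : forall p : V * R, A p -> 0 <= p.2 ^+ j.
  by move=> p [_ /andP[p0 _] _]; exact: exprn_ge0.
elim=> [_|j IH jd].
  apply: dominatedB.
    apply: dominated_sum => [p _|i]; first by rewrite expr0.
    apply: (@dominated_weaken _ _ _ A A _ (fun p => 1 * 1) _ 1) => //.
    apply: dominatedZ; last first.
      apply: (dominated_comp (A := [set x | `|x| <= rho]) (phi := fst) (w := fun=> 1)).
        by move=> p [].
      exact: flow_coef_bounded.
    exists i.+1%:R => // p [_ /andP[p0 p1] _].
    by rewrite normrM normr_nat ler_wpM2l// normrX ger0_norm// exprn_ile1.
  have [B B0 fB] := continuous_bounded_ball rho' (class_C_le (leq0n d) cf).
  exists B => // -[x s] [/= xr s0 /(_ s)]; rewrite expr0 mulr1 => sr; apply/fB/sr.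
  by case/andP: s0 => ->; rewrite lexx.
have [B B0 dB] := IH (ltnW jd).
apply: dominated_row => [p|m]; first exact: A0.
have cfm k : (k <= d)%N -> of_class_C k (lie f (coordinate m)).
  move=> kd; rewrite (_ : lie _ _ = fun x => f x 0 m).
    exact/class_C_coord/(class_C_le kd).
  by apply/funext => x; rewrite lie_coordinate.
have [C C0 tC] := lie_taylor rho' B0 (class_C_le (ltnW jd) cf : of_class_C j.+1.-1 f) (cfm _ jd).
have [D D0 tD] := lie_poly_trunc rho jd cf (cfm _ (leqnn d)).
exists (D + C) => [|[x s] [/= xr s01 fr]]; first exact: addr_ge0.
have /andP[s0 s1] := s01.
rewrite !mxE lie_flow'_coord deriv_lie_poly -lie_coordinate.
set p := lie_poly _ _ _ _; set q := lie_poly f (lie f (coordinate m)) j.+1 x.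
have -> : p.[s] - lie f (coordinate m) (lie_flow x s) =
    (p.[s] - q.[s]) - (lie f (coordinate m) (lie_flow x s) - q.[s]).
  by rewrite opprB addrA subrK.
rewrite mulrDl (le_trans (ler_normB _ _))// lerD//; first exact: tD.
rewrite /q -[X in lie_poly _ _ _ X]lie_flow0.
apply: (tC s (lie_flow x) (lie_flow' x)) => //.
- exact/continuous_subspaceT/continuous_lie_flow.
- by move=> *; exact: is_derive_lie_flow.
move=> t /andP[t0 ts]; apply: (dB (x, t)); split=> //=.
  by rewrite ltW//= (le_trans (ltW ts)).
by move=> r /andP[r0 rt]; apply: fr; rewrite r0 (le_trans rt)// ltW.
Qed.

End LieFlow.


(** * Dependence of P on time and starting point, and comparison with the exact solution *)

Section FlowEstimates.
Context {R : realType} {n : nat}.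
Local Notation V := 'rV[R]_n.
Variables (f : V -> V) (d : nat).
Hypothesis cf : of_class_C d f.
Hypothesis d0 : (0 < d)%N.

Lemma lie_flow_split k x s : (k <= d.+1)%N ->
  lie_flow f d x s = \sum_(i < k) s ^+ i *: flow_coef f i x +
    \sum_(i < d.+1) (if (k <= i)%N then s ^+ i *: flow_coef f i x else 0).
Proof.
move=> kd; rewrite /lie_flow (bigID (fun i : 'I_d.+1 => (i < k)%N)) /=; congr (_ + _).
  by rewrite -(big_ord_widen _ (fun i => s ^+ i *: flow_coef f i x) kd).
by rewrite -big_mkcond /=; apply: eq_bigl => i; rewrite -leqNgt.
Qed.

Lemma lie_flow_remainder k rho : (k <= d.+1)%N ->
  dominated_on [set p : V * R | `|p.1| <= rho /\ 0 <= p.2 <= 1] (fun p => p.2 ^+ k)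
    (fun p => lie_flow f d p.1 p.2 - \sum_(i < k) p.2 ^+ i *: flow_coef f i p.1).
Proof.
move=> kd; set A := [set p | _].
have A0 : forall p, A p -> 0 <= p.2 ^+ k by move=> p [_ /andP[p0 _]]; exact: exprn_ge0.
apply: (@eq_dominated _ _ _ _ _ (fun p => \sum_(i < d.+1)
    (if (k <= i)%N then p.2 ^+ i *: flow_coef f i p.1 else 0))).
  by move=> p _; rewrite (lie_flow_split _ _ kd) addrAC subrr add0r.
apply: dominated_sum => // i; have [ki|_] := leqP k i; last exact: dominated0.
apply: (@dominated_weaken _ _ _ A A _ (fun p => p.2 ^+ k * 1) _ 1) => //.
  by move=> p _; rewrite mulr1 mul1r.
apply: dominatedZ.
  exists 1 => // p [_ /andP[p0 p1]].
  by rewrite mul1r normrX ger0_norm// ler_wiXn2l.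
apply: (dominated_comp (A := [set x | `|x| <= rho]) (phi := fst) (w := fun=> 1)).
  by move=> p [].
by apply: flow_coef_bounded cf _ _ _; rewrite -ltnS.
Qed.

Lemma lie_flow_displacement rho :
  dominated_on [set p : V * R | `|p.1| <= rho /\ 0 <= p.2 <= 1] (fun p => p.2)
    (fun p => lie_flow f d p.1 p.2 - p.1).
Proof.
have := @lie_flow_remainder 1 rho isT.
apply: eq_dominated => p _.
by rewrite big_ord1 expr0 scale1r flow_coef0.
Qed.

(** The terms of degree at most 1 cancel exactly, and g^i - 1 = (g - 1)(1 + g + ... + g^(i-1))
    extracts the factor g - 1 from each remaining one. The condition on g bounds it by 2, hence also
    the geometric sum. *)
Lemma lie_flow_rescale rho :
  dominated_on [set p : V * R * R | [/\ `|p.1.1| <= rho, 0 <= p.1.2 <= 1 & `|p.2 - 1| <= 1]]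
    (fun p => `|p.2 - 1| * p.1.2 ^+ 2)
    (fun p => lie_flow f d p.1.1 (p.2 * p.1.2) - lie_flow f d p.1.1 p.1.2 -
      ((p.2 - 1) * p.1.2) *: f p.1.1).
Proof.
set A := [set p | _].
have A0 : forall p, A p -> 0 <= `|p.2 - 1| * p.1.2 ^+ 2.
  by move=> p [_ /andP[p0 _] _]; rewrite mulr_ge0// exprn_ge0.
apply: (@eq_dominated _ _ _ _ _ (fun p => \sum_(i < d.+1)
    (if (2 <= i)%N then
      ((p.2 - 1) * ((\sum_(j < i) p.2 ^+ j) * p.1.2 ^+ i)) *: flow_coef f i p.1.1 else 0))).
  move=> [[x s] g] _ /=; rewrite !(lie_flow_split _ _ (d0 : (2 <= d.+1)%N)).
  have E2 t : \sum_(i < 2) t ^+ i *: flow_coef f i x = x + t *: f x.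
    by rewrite big_ord_recl big_ord1 expr0 scale1r flow_coef0 flow_coef1.
  rewrite !E2.
  have E : \sum_(i < d.+1) (if (2 <= i)%N then
      ((g - 1) * ((\sum_(j < i) g ^+ j) * s ^+ i)) *: flow_coef f i x else 0) =
     \sum_(i < d.+1) (if (2 <= i)%N then (g * s) ^+ i *: flow_coef f i x else 0) -
     \sum_(i < d.+1) (if (2 <= i)%N then s ^+ i *: flow_coef f i x else 0).
    rewrite -sumrB; apply: eq_bigr => i _; case: ifP => _; last by rewrite subr0.
    by rewrite mulrA -subrX1 -scalerBl exprMn mulrBl mul1r.
  by rewrite E; apply/rowP => m; rewrite !mxE; ring.
apply: dominated_sum => // i; have [i2|_] := leqP 2 i; last exact: dominated0.
apply: (@dominated_weaken _ _ _ A A _ (fun p => `|p.2 - 1| * (1 * p.1.2 ^+ 2) * 1) _ 1) => //.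
  by move=> p _; rewrite !(mulr1, mul1r).
apply: dominatedZ; last first.
  apply: (dominated_comp (A := [set x | `|x| <= rho]) (phi := fun p => p.1.1) (w := fun=> 1)).
    by move=> p [].
  by apply: flow_coef_bounded cf _ _ _; rewrite -ltnS.
apply: (@dominatedZ _ _ R^o); first by exists 1 => // p _; rewrite mul1r.
apply: (@dominatedZ _ _ R^o).
  apply: dominated_sum => // j; exists (2 ^+ j) => // p [_ _ p1].
  rewrite mulr1 normrX; apply: lerXn2r; rewrite ?nnegrE//.
  by move: p1; rewrite !ler_norml; lra.
exists 1 => // p [_ /andP[p0 p1] _].
by rewrite mul1r normrX ger0_norm// ler_wiXn2l.
Qed.

(** The constant term of P is x itself, so subtracting it leaves a factor s. This factor makes the
    amplification of the error in one step 1 + O(dt), as discrete Gronwall requires. *)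
Lemma lie_flow_lipschitz rho :
  dominated_on [set p : V * V * R | [/\ `|p.1.1| <= rho, `|p.1.2| <= rho & 0 <= p.2 <= 1]]
    (fun p => p.2 * `|p.1.1 - p.1.2|)
    (fun p => lie_flow f d p.1.1 p.2 - lie_flow f d p.1.2 p.2 - (p.1.1 - p.1.2)).
Proof.
set A := [set p | _].
have A0 : forall p, A p -> 0 <= p.2 * `|p.1.1 - p.1.2|.
  by move=> p [_ _ /andP[p0 _]]; rewrite mulr_ge0.
apply: (@eq_dominated _ _ _ _ _ (fun p => \sum_(i < d.+1)
    (if (1 <= i)%N then p.2 ^+ i *: (flow_coef f i p.1.1 - flow_coef f i p.1.2) else 0))).
  move=> [[x x'] s] _ /=; rewrite !(lie_flow_split _ _ (isT : (1 <= d.+1)%N)).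
  rewrite !big_ord1 !expr0 !scale1r !flow_coef0.
  have -> : \sum_(i < d.+1) (if (1 <= i)%N then
      s ^+ i *: (flow_coef f i x - flow_coef f i x') else 0) =
     \sum_(i < d.+1) (if (1 <= i)%N then s ^+ i *: flow_coef f i x else 0) -
     \sum_(i < d.+1) (if (1 <= i)%N then s ^+ i *: flow_coef f i x' else 0).
    rewrite -sumrB; apply: eq_bigr => i _; case: ifP => _; last by rewrite subr0.
    by rewrite scalerBr.
  by apply/rowP => m; rewrite !mxE; ring.
apply: dominated_sum => // i; have [i1|_] := leqP 1 i; last exact: dominated0.
apply: dominatedZ.
  exists 1 => // p [_ _ /andP[p0 p1]].
  by rewrite mul1r normrX ger0_norm// -[leRHS]expr1 ler_wiXn2l.
apply: (dominated_comp (A := [set p : V * V | `|p.1| <= rho /\ `|p.2| <= rho])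
  (phi := fun p => p.1) (w := fun p => `|p.1 - p.2|) (u := fun p => _ p.1 - _ p.2)).
  by move=> p [].
by apply: flow_coef_lipschitz cf _ _ _; rewrite -ltnS.
Qed.

(** [lie_taylor] without defect, applied to the time translates of y and to each coordinate with d +
    1 terms; f of class C^d is just enough for this. *)
Lemma lie_flow_solution (t0 T : R) y0 (y : R -> V) rho :
  ode_solution f t0 T y0 y -> (forall t, t0 <= t <= T -> `|y t| <= rho) ->
  dominated_on [set p : R * R | [/\ t0 <= p.1, 0 <= p.2 <= 1 & p.1 + p.2 <= T]]
    (fun p => p.2 ^+ d.+1)
    (fun p => y (p.1 + p.2) - lie_flow f d (y p.1) p.2).
Proof.
move=> [_ cy dy] yr; apply: dominated_row => [p [_ /andP[p0 _] _]|m]; first exact: exprn_ge0.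
have [C C0 tC] := lie_taylor rho (lexx 0) (cf : of_class_C d.+1.-1 f)
  (class_C_coordinate d.+1 m).
exists C => // -[t s] [/= tt0 /andP[s0 s1] tsT].
rewrite !mxE lie_flow_coord; have := tC s (fun r => y (t + r)) (fun r => f (y (t + r))).
rewrite addr0; apply; rewrite ?s0//.
- apply/subspace_continuousP => r /=; rewrite in_itv /= => /andP[r0 rs].
  move/subspace_continuousP: cy => /(_ (t + r)) /=; rewrite in_itv /= => cy.
  apply: (cvg_comp _ _ _ (cy _)); last by lra.
  move=> P; rewrite /within /= => nP.
  have ct : {for r, continuous ( +%R t)} by apply: continuousD => //; exact: cst_continuous.
  have : \forall x \near r, t + x \in `[t0, T] -> P (t + x) by exact: (ct _ nP).
  apply: filterS => x /= Px; rewrite in_itv /= => /andP[x0 xs]; apply: Px.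
  by rewrite in_itv /=; lra.
- move=> r /andP[r0 rs].
  have dyr : is_derive (t + r) (1 : R) y (f (y (t + r))) by apply: dy; lra.
  have /derivable1_diffP dy' := @ex_derive _ _ _ _ _ _ _ dyr.
  have ds : is_derive r (1 : R) ( +%R t) (1 : R).
    by have := is_deriveD (is_derive_cst t r (1 : R)) (is_derive_id r (1 : R)); rewrite add0r.
  have /derivable1_diffP ds' := @ex_derive _ _ _ _ _ _ _ ds.
  apply: DeriveDef.
    by apply/derivable1_diffP; apply: differentiable_comp.
  rewrite deriveE; last exact: differentiable_comp.
  by rewrite diff_comp//= -(deriveE _ ds') derive_val -(deriveE _ dy') derive_val.
- move=> r /andP[r0 rs]; apply: yr; rewrite (le_trans tt0) ?lerDl//=.
  by rewrite (le_trans _ tsT)// lerD2l.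
- by move=> r _; rewrite subrr normr0 mul0r.
Qed.

End FlowEstimates.


(** * The quadrature weights *)

Section Quadrature.
Context {R : realType}.

Lemma Rintegral_deriv_horner (Q : {poly R}) a b : a <= b ->
  \int[lebesgue_measure]_(s in `[a, b]) (Q^`()).[s] = Q.[b] - Q.[a].
Proof.
rewrite le_eqVlt => /predU1P[<-|ab].
  by rewrite set_itv1 Rintegral_set1 subrr.
rewrite /Rintegral (@continuous_FTC2 _ _ (horner Q)) //=.
- by apply: continuous_subspaceT; exact: continuous_horner.
- split; first by move=> x _; exact: derivable_horner.
    by apply: cvg_at_right_filter; exact: continuous_horner.
  by apply: cvg_at_left_filter; exact: continuous_horner.
- by move=> x _; rewrite derivE.
Qed.

Definition poly_primitive (p : {poly R}) : {poly R} :=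
  \poly_(i < (size p).+1) (p`_i.-1 / i%:R).

Lemma deriv_poly_primitive p : (poly_primitive p)^`() = p.
Proof.
apply/polyP => i; rewrite coef_deriv coef_poly ltnS.
case: ltnP => [_|si]; last by rewrite mul0rn nth_default.
by rewrite -[LHS]mulr_natr /= divfK // pnatr_eq0.
Qed.

Lemma poly_primitive0 p : (poly_primitive p).[0] = 0.
Proof. by rewrite horner_coef0 coef_poly invr0 mulr0. Qed.

Lemma lagrange_ext n (x x' : nat -> R) : (forall i, (i < n)%N -> x i = x' i) ->
  lagrange n x = lagrange n x'.
Proof.
move=> xx'; rewrite [lagrange n x]unlock [lagrange n x']unlock; apply: eq_from_tnth => i.
rewrite !tnth_map tnth_ord_tuple; congr (npolyp _ _).
have Ep : \prod_(j < n | j != i :> nat) ('X - (x j)%:P) =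
    \prod_(j < n | j != i :> nat) ('X - (x' j)%:P).
  by apply: eq_bigr => j _; rewrite xx'.
by cbv zeta; rewrite !Ep xx'.
Qed.

Variables (M : nat) (c : nat -> R).
Hypothesis hc : subtimestep_positions M c.

Lemma subtimestep_homo i j : (i <= j <= M)%N -> c i <= c j.
Proof.
have [_ _ ci] := hc; elim: j => [|j IH] /andP[ij jM].
  by move: ij; rewrite leqn0 => /eqP ->.
move: ij; rewrite leq_eqVlt => /predU1P[->//|ij].
by rewrite (le_trans (IH _))// ?(ltW (ci _ _))// -ltnS ij ltnW.
Qed.

Lemma subtimestep_ge0 i : (i <= M)%N -> 0 <= c i <= 1.
Proof.
have [c0 cM _] := hc => iM.
by rewrite -{1}c0 -cM !subtimestep_homo //= ?iM ?leqnn.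
Qed.

(* The library lemmas on Lagrange polynomials ask for nodes that are injective on
   all of nat, whereas c is only controlled up to M. *)
Lemma subtimestep_inj : exists2 c' : nat -> R, injective c' &
  forall i, (i <= M)%N -> c' i = c i.
Proof.
have [c0 cM ci] := hc; pose c' i := if (i <= M)%N then c i else i.+1%:R.
exists c'; last by move=> i iM; rewrite /c' iM.
have c'S i : c' i < c' i.+1.
  rewrite /c'; case: (ltngtP i M) => [iM|Mi|->].
  - by rewrite ci.
  - by rewrite ltr_nat.
  - by rewrite cM ltr1n.
exact/inc_inj/Order.NatMonotonyTheory.incnP.
Qed.

Lemma subtimeE dt tn i : subtime c dt tn i = tn + c i * dt.
Proof. by []. Qed.

(** Exactness on polynomials of degree at most M, stated through a primitive Q of degree at most M +
    1 so that integrals become differences of values. *)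
Lemma theta_quadrature dt tn (Q : {poly R}) m : 0 < dt -> (m <= M)%N ->
  (size Q <= M.+2)%N ->
  \sum_(r < M.+1) theta M.+1 c dt tn r m * (Q^`()).[c r] = Q.[c m] - Q.[c 0%N].
Proof.
move=> dt0 mM sQ; have [c' c'inj c'E] := subtimestep_inj.
have dtn0 : dt != 0 by rewrite gt_eqF.
have tinj : injective (subtime c' dt tn).
  by move=> i j /addrI /(mulIf dtn0); exact: c'inj.
pose L := lagrange M.+1 (subtime c' dt tn).
have LE (r : 'I_M.+1) : lagrange_poly M.+1 c dt tn r = tnth L r.
  rewrite /lagrange_poly /= (@lagrange_ext _ _ (subtime c' dt tn)); last first.
    by move=> i iM; rewrite /subtime c'E.
  by rewrite nth_lagrange.
pose A (r : 'I_M.+1) := poly_primitive (tnth L r : {poly R}).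
(* Affine change of variable sending the subtimesteps to their relative positions. *)
pose q : {poly R} := dt^-1 *: ('X - tn%:P).
have qE i : (i <= M)%N -> q.[subtime c dt tn i] = c i.
  move=> iM; rewrite /q /subtime !hornerE addrAC subrr add0r mulrC -mulrA divff//.
  by rewrite mulr1.
have ab : subtime c dt tn 0 <= subtime c dt tn m.
  by rewrite /subtime lerD2l ler_pM2r// subtimestep_homo.
pose S := \sum_(r < M.+1) (Q^`()).[c r] *: A r.
pose P := dt *: (Q \Po q).
have SP : S^`() = P^`().
  have -> : P^`() = Q^`() \Po q.
    rewrite /P derivZ deriv_comp /q derivZ derivXsubC -scalerAr mulr1 scalerA.
    by rewrite divff// scale1r.
  have sp : (size (Q^`() \Po q) <= M.+1)%N.
    have sq : (size q <= 2)%N by rewrite (leq_trans (size_scale_leq _ _))// size_XsubC.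
    have sQ' : (size Q^`() <= M.+1)%N.
      by rewrite (leq_trans (size_poly _ _))//; move: sQ; case: (size Q).
    rewrite (leq_trans (size_comp_poly_leq _ _))//; nia.
  rewrite [RHS](lagrange_gen _ tinj sp)// /S raddf_sum; apply: eq_bigr => r _.
  rewrite /= derivZ deriv_poly_primitive -mul_polyC; congr (_%:P * _).
  have rM : (r <= M)%N by rewrite -ltnS.
  by rewrite horner_comp /subtime c'E // -subtimeE qE.
have thetaE (r : 'I_M.+1) : theta M.+1 c dt tn r m =
    dt^-1 * ((A r).[subtime c dt tn m] - (A r).[subtime c dt tn 0]).
  by rewrite -Rintegral_deriv_horner// deriv_poly_primitive /theta LE.
transitivity (dt^-1 * (S.[subtime c dt tn m] - S.[subtime c dt tn 0])).
  rewrite /S !horner_sum -sumrB mulr_sumr; apply: eq_bigr => r _.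
  by rewrite thetaE !hornerZ -mulrBr [RHS]mulrCA mulrC.
rewrite -Rintegral_deriv_horner// SP Rintegral_deriv_horner//.
by rewrite /P !hornerZ !horner_comp !qE// -mulrBr mulKf.
Qed.

(** The integral from 0 to c m of the r-th Lagrange polynomial on the reference nodes: [theta] freed
    from dt and tn, so that constants can be uniform in both. *)
Definition quad_weight r m : R := (poly_primitive ((lagrange M.+1 c)`_r : {poly R})).[c m].

(** No substitution in the integral is needed: exactness is applied to the primitive of the r-th
    reference Lagrange polynomial, and the nodal values reduce the sum to the single term r. *)
Lemma theta_quad_weight dt tn r m : 0 < dt -> (r <= M)%N -> (m <= M)%N ->
  theta M.+1 c dt tn r m = quad_weight r m.
Proof.
move=> dt0 rM mM; have [c0 _ _] := hc; have [c' c'inj c'E] := subtimestep_inj.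
have r_lt : (r < M.+1)%N by rewrite ltnS.
set p := (lagrange M.+1 c)`_r : {poly R}.
have pE : p = tnth (lagrange M.+1 c') (Ordinal r_lt).
  rewrite /p (@lagrange_ext _ _ c'); last by move=> i iM; rewrite c'E.
  by rewrite -nth_lagrange.
have := @theta_quadrature dt tn (poly_primitive p) m dt0 mM _.
rewrite deriv_poly_primitive c0 poly_primitive0 subr0 /quad_weight -/p => <-; last first.
  by rewrite (leq_trans (size_poly _ _))// ltnS pE size_lagrange_.
rewrite (bigD1 (Ordinal r_lt))//= big1 => [|i ir].
  rewrite addr0 pE -[c r]c'E// (@lagrange_sample _ _ _ _ _ (Ordinal r_lt) (Ordinal r_lt))//.
  by rewrite eqxx mulr1.
have iM : (i <= M)%N by rewrite -ltnS.
by rewrite pE -c'E// lagrange_sample// eq_sym (negPf ir) mulr0.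
Qed.

Lemma quad_weight_exact j m : (j <= M)%N -> (m <= M)%N ->
  \sum_(r < M.+1) quad_weight r m * (j.+1%:R * c r ^+ j) = c m ^+ j.+1.
Proof.
move=> jM mM; have [c0 _ _] := hc.
have := @theta_quadrature 1 0 'X^(j.+1) m ltr01 mM _.
rewrite size_polyXn !ltnS => /(_ jM); rewrite c0 !hornerE expr0n subr0 => <-.
apply: eq_bigr => r _; rewrite theta_quad_weight//; last by rewrite -ltnS.
by rewrite derivXn hornerMn hornerXn mulr_natl.
Qed.

End Quadrature.


(** * The relaxed step in terms of the correction iterates *)

Section RungeKutta.

(* The stages 1, ..., M^2 come in M blocks of M nodes; only block k contributes. *)
Lemma sum_blocks (U : zmodType) (M k : nat) (a : U) (H : nat -> U) :
  (0 < k <= M)%N ->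
  \sum_(i < nb_stages M.+1) (if i == 0%N :> nat then a
     else if stage_iter M.+1 i == k then H (stage_node M.+1 i) else 0) =
  a + \sum_(r < M) H r.+1.
Proof.
move=> /andP[k0 kM]; have M0 : (0 < M)%N by exact: leq_trans kM.
rewrite /nb_stages addn1 big_ord_recl /=; congr (_ + _).
rewrite (eq_bigr (fun i : 'I_(M ^ 2) => if (i %/ M).+1 == k then H (i %% M).+1 else 0)) //.
rewrite -(big_mkord xpredT (fun i => if (i %/ M).+1 == k then H (i %% M).+1 else 0)).
have le1 : (k.-1 * M <= k * M)%N by rewrite leq_mul2r leq_pred orbT.
have le2 : (k * M <= M ^ 2)%N by rewrite -mulnn leq_mul2r kM orbT.
rewrite (big_cat_nat _ (leq_trans le1 le2))//= (big_cat_nat le1 le2)//=.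
rewrite big_nat_cond big1 ?add0r => [|i /andP[/andP[_ ik] _]]; last first.
  by rewrite ifF// -(prednK k0) eqSS ltn_eqF// ltn_divLR.
rewrite addrC big_nat_cond big1 ?add0r => [|i /andP[/andP[ik _] _]]; last first.
  by rewrite ifF// gtn_eqF// ltnS leq_divRL.
rewrite -{1}[(k.-1 * M)%N]add0n big_addn.
have -> : (k * M - k.-1 * M = M)%N by rewrite -{1}(prednK k0) mulSn addnK.
rewrite big_mkord; apply: eq_bigr => r _.
by rewrite addnC divnMDl// divn_small// addn0 modnMDl modn_small// prednK// eqxx.
Qed.

Lemma sum_block0 (U : zmodType) (M : nat) (a : U) :
  \sum_(i < nb_stages M.+1) (if i == 0%N :> nat then a else 0) = a.
Proof. by rewrite /nb_stages addn1 big_ord_recl /= big1 ?addr0. Qed.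

Context {R : realType} {n : nat}.
Local Notation V := 'rV[R]_n.
Variables (dot : {dot V for idfun}) (M : nat) (c : nat -> R) (f : V -> V).
Hypothesis hc : subtimestep_positions M c.
Hypothesis M0 : (0 < M)%N.
Local Notation w := (quad_weight M c).
Local Notation d := M.+1.

(** The scheme without its last correction, which enters through [increment]. Node 0 obeys the same
    recursion as the others, since its weights are integrals over a degenerate interval. *)
Definition corrections (dt : R) (x : V) (Y : nat -> nat -> V) : Prop :=
  [/\ forall k, (k <= M)%N -> Y k 0%N = x,
      forall m, (m <= M)%N -> Y 0%N m = x &
      forall k m, (k < M)%N -> (m <= M)%N ->
        Y k.+1 m = x + dt *: \sum_(r < d) w r m *: f (Y k r)].

Definition increment (Y : nat -> nat -> V) : V := \sum_(r < d) w r M *: f (Y M r).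

(* The numerator of gamma: the a_ij are eliminated through
   dt * sum_j a_ij f_j = u_i - x. *)
Definition work (dt : R) (x : V) (Y : nat -> nat -> V) : R :=
  2 * \sum_(r < d) w r M * (dt^-1 * dot (f (Y M r)) (Y M r - x)).

Definition relaxation (dt : R) (x : V) (Y : nat -> nat -> V) : R :=
  let D := dot (increment Y) (increment Y) in
  if D != 0 then work dt x Y / D else 1.

Lemma dotC (u v : V) : dot u v = dot v u.
Proof. by rewrite (hermC dot) expr0 mul1r. Qed.

Lemma dotZl a (u v : V) : dot (a *: u) v = a * dot u v.
Proof. exact: linearZl_LR. Qed.

Lemma dotZr a (u v : V) : dot u (a *: v) = a * dot u v.
Proof. by rewrite dotC dotZl dotC. Qed.

Lemma dot_suml k (E : 'I_k -> V) v : dot (\sum_(i < k) E i) v = \sum_(i < k) dot (E i) v.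
Proof. exact: linear_sumlz. Qed.

Lemma dot_sumr k (E : 'I_k -> V) v : dot v (\sum_(i < k) E i) = \sum_(i < k) dot v (E i).
Proof. by rewrite dotC dot_suml; apply: eq_bigr => i _; rewrite dotC. Qed.

Lemma dot_ge0 (u : V) : 0 <= dot u u.
Proof.
have [->|u0] := eqVneq u 0; first by rewrite linear0l.
by rewrite ltW// neq0_dnorm_gt0.
Qed.

Section Step.
Variables (dt tn : R) (x : V) (g : R) (Y : nat -> nat -> V).
Hypothesis dt0 : 0 < dt.
Hypothesis hY : rdec_corrections d c f dt tn x g Y.

Let c0 : c 0%N = 0. Proof. by case: hc. Qed.

Lemma quad_weight0 r : w r 0 = 0.
Proof. by rewrite /quad_weight c0 poly_primitive0. Qed.

(** The Euler terms of L^1 depend only on the common value at node 0 and cancel, which turns each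
    correction into an explicit Picard iteration with quadrature. *)
Lemma rdec_correction_eq k m : (k < d)%N -> (0 < m <= M)%N ->
  Y k.+1 m = x + ((if (k == M) && (m == M) then g else 1) * dt) *:
    \sum_(r < d) w r m *: f (Y k r).
Proof.
move=> kd mM; have [Yk0 _ /(_ k.+1 m kd mM)] := hY.
rewrite /L1 !Yk0 ?(ltnW kd)// => E.
have {}E : Y k.+1 m = Y k m - L2_relaxed d c f dt tn g k.+1 (Y k) m.
  move: E; set b := _ *: f x => /(congr1 (fun v => v + b + x)).
  by rewrite !subrK [X in X + x]addrAC subrK addrAC subrK.
have L2E : L2_relaxed d c f dt tn g k.+1 (Y k) m =
    L2_scaled d c f dt tn (if (k == M) && (m == M) then g else 1) (Y k) m.
  by rewrite /L2_relaxed eqSS /=; case: ifP.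
have mM' : (m <= M)%N by case/andP: mM.
rewrite E L2E /L2_scaled Yk0 1?ltnW// !opprD !opprK -[- _ + _ + _]addrA addNKr.
congr (_ + _ *: _).
by apply: eq_bigr => r _; rewrite theta_quad_weight// -ltnS.
Qed.

Lemma rdec_corrections_reduced : corrections dt x Y /\ Y d M = x + (g * dt) *: increment Y.
Proof.
have [Yk0 Y0m _] := hY; split; last first.
  by rewrite rdec_correction_eq ?M0 ?leqnn// eqxx.
split=> [k kM|[|m] mM|k [|m] kM mM]; first by rewrite Yk0// ltnW.
- by rewrite Yk0.
- by rewrite Y0m.
- rewrite Yk0 ?big1 ?scaler0 ?addr0//; last exact: ltnW.
  by move=> r _; rewrite quad_weight0 scale0r.
have := @rdec_correction_eq k m.+1 (ltnW kM) mM.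
by rewrite (ltn_eqF kM) mul1r.
Qed.

Lemma stage_node_le i : (stage_node d i <= M)%N.
Proof. by rewrite /stage_node /= ltn_pmod. Qed.

Let Y0 k : (k <= M)%N -> Y k 0%N = x.
Proof. by have [h _ _] := rdec_corrections_reduced.1; exact: h. Qed.

Lemma rk_increment :
  \sum_(i < nb_stages d) rk_b d c dt tn i *: f (stage d x Y i) = increment Y.
Proof.
rewrite /increment big_ord_recl Y0 ?leqnn// -(@sum_blocks _ M M _ (fun m => w m M *: f (Y M m))).
  apply: eq_bigr => i _; rewrite /rk_b /stage; case: ifP => _.
    by rewrite theta_quad_weight.
  case: ifP => [/eqP ->|_]; last by rewrite scale0r.
  by rewrite theta_quad_weight// stage_node_le.
by rewrite M0 leqnn.
Qed.

Lemma rk_stage i : i != 0%N -> (stage_iter d i <= M)%N ->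
  dt *: \sum_(j < nb_stages d) rk_a d c dt tn i j *: f (stage d x Y j) =
  stage d x Y i - x.
Proof.
move=> i0 iM; rewrite /stage (negPf i0); have mM := stage_node_le i.
have [_ Y0m Yk] := rdec_corrections_reduced.1.
set m := stage_node d i in mM *; case Ek : (stage_iter d i) => [//|k] in iM *.
rewrite Yk// addrC addKr; congr (_ *: _).
(* The first correction has coefficients [beta] instead of [theta]. There all slopes equal [f x],
   and exactness on constants makes the weights sum to c m, which is [beta]. *)
case: k => [|k] in Ek iM *.
  rewrite (eq_bigr (fun j : 'I_(nb_stages d) =>
      if j == 0%N :> nat then beta d c dt tn m *: f x else 0)); last first.
    move=> j _; rewrite /rk_a (negPf i0) Ek; case: eqP => _.
      by rewrite eqxx.
    by rewrite eqSS eq_sym /= scale0r.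
  rewrite sum_block0 (eq_bigr (fun r : 'I_d => w r m *: f x)); last first.
    by move=> r _; rewrite Y0m// -ltnS.
  rewrite -scaler_suml; congr (_ *: _).
  have := quad_weight_exact hc (leq0n M) mM; rewrite expr1 => wE.
  transitivity (c m); last by rewrite -wE; apply: eq_bigr => r _; rewrite expr0 !mulr1.
  have [_ c1 _] := hc; rewrite /beta /subtime /= c0 c1 mul0r addr0 mul1r.
  by rewrite [tn + _]addrC addrK addrC addKr mulfK// gt_eqF.
rewrite big_ord_recl Y0 1?ltnW// -(@sum_blocks _ M k.+1 _ (fun r => w r m *: f (Y k.+1 r))).
  apply: eq_bigr => j _; rewrite /rk_a (negPf i0) Ek /=; case: ifP => _.
    by rewrite theta_quad_weight.
  rewrite eqSS eq_sym; case: ifP => [/eqP ->|_]; last by rewrite scale0r.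
  by rewrite theta_quad_weight// stage_node_le.
exact: ltnW.
Qed.

Lemma relaxation_coeffE : relaxation_coeff dot d c f dt tn x Y = relaxation dt x Y.
Proof.
rewrite /relaxation_coeff /relaxation rk_increment /dot_norm sqr_sqrtr ?dot_ge0//.
case: ifP => // _; congr (_ / _).
  (* Stage 0 contributes nothing on either side: its row of [rk_a] is zero, and Y M 0 = x. Of the
     other stages [rk_b] keeps the last block, where [rk_stage] evaluates the inner sum. *)
  rewrite /work; congr (_ * _); rewrite big_ord_recl Y0 ?leqnn// subrr linear0r !mulr0.
  rewrite -(@sum_blocks _ M M 0 (fun m => w m M * (dt^-1 * dot (f (Y M m)) (Y M m - x)))).
    apply: eq_bigr => i _.
    rewrite (eq_bigr (fun j : 'I_(nb_stages d) => rk_b d c dt tn i *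
        dot (f (stage d x Y i)) (rk_a d c dt tn i j *: f (stage d x Y j)))); last first.
      by move=> j _; rewrite dotZr mulrA.
    rewrite -mulr_sumr -dot_sumr.
    have [i0|i0] := boolP (i == 0%N :> nat).
      by rewrite big1 ?linear0r ?mulr0// => j _; rewrite /rk_a i0 scale0r.
    rewrite /rk_b (negPf i0); case: eqP => iM; last by rewrite mul0r.
    rewrite theta_quad_weight ?stage_node_le//; congr (_ * _).
    have := @rk_stage i i0; rewrite iM leqnn => /(_ isT) E.
    rewrite /stage (negPf i0) iM in E *; rewrite -E dotZr mulKf//.
    by rewrite gt_eqF.
  by rewrite M0 leqnn.
rewrite -rk_increment dot_suml; apply: eq_bigr => i _.
rewrite dot_sumr; apply: eq_bigr => j _.
by rewrite dotZl dotZr mulrA.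
Qed.

End Step.

(** There is no implicit equation for gamma: it affects only correction K, whereas its value reads
    only the iterates of level M = K - 1. *)
Lemma rdec_step_reduced dt tn x tn1 x1 : 0 < dt ->
  rdec_step dot d c f dt tn x tn1 x1 ->
  exists Y, let g := relaxation dt x Y in
    [/\ corrections dt x Y, tn1 = tn + g * dt & x1 = x + (g * dt) *: increment Y].
Proof.
move=> dt0 [Y [hY tE xE]]; exists Y; have [cY YdM] := rdec_corrections_reduced dt0 hY.
by split=> //; rewrite -(relaxation_coeffE dt0 hY)// xE YdM.
Qed.

End RungeKutta.


(** * Local error *)

Section LocalError.
Context {R : realType} {n : nat}.
Local Notation V := 'rV[R]_n.
Variables (dot : {dot V for idfun}) (M : nat) (c : nat -> R) (f : V -> V).
Hypothesis hc : subtimestep_positions M c.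
Hypothesis M0 : (0 < M)%N.
Hypothesis cf : of_class_C M.+1 f.
Local Notation w := (quad_weight M c).
Local Notation d := M.+1.
Local Notation P := (lie_flow f M.+1).
Local Notation P' := (lie_flow' f M.+1).
Local Notation F := (flow_coef f).
Local Notation S := (R * V * (nat -> nat -> V))%type.

Lemma scale_regular (a b : R) : a *: (b : R^o) = a * b.
Proof. by []. Qed.

Lemma dotBl (u v z : V) : dot (u - v) z = dot u z - dot v z.
Proof. exact: linearBl. Qed.

Lemma dotBr (u v z : V) : dot z (u - v) = dot z u - dot z v.
Proof. by rewrite dotC dotBl !(dotC _ z). Qed.

Lemma dot_bounded : exists2 B : R, 0 <= B & forall u v : V, `|dot u v| <= B * (`|u| * `|v|).
Proof.
exists (\sum_(i < n) \sum_(j < n) `|dot (delta_mx 0 i) (delta_mx 0 j)|).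
  by apply: sumr_ge0 => i _; apply: sumr_ge0.
move=> u v; rewrite {1}(row_sum_delta u) dot_suml mulr_suml.
rewrite (le_trans (ler_norm_sum _ _ _))// ler_sum// => i _.
rewrite {1}(row_sum_delta v) dot_sumr mulr_suml.
rewrite (le_trans (ler_norm_sum _ _ _))// ler_sum// => j _.
rewrite dotZl dotZr !normrM mulrA mulrC ler_wpM2l// ler_pM//; exact: row_norm_ge.
Qed.

Lemma dominated_dot T (A : set T) (a b : T -> R) (u v : T -> V) :
  dominated_on A a u -> dominated_on A b v ->
  dominated_on A (fun s => a s * b s) (fun s => dot (u s) (v s)).
Proof.
move=> [C C0 uC] [D D0 vD]; have [B B0 dB] := dot_bounded.
exists (B * (C * D)) => [|s As]; first by rewrite !mulr_ge0.
rewrite (le_trans (dB _ _))// -[leRHS]mulrA ler_wpM2l// mulrACA.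
by rewrite ler_pM// ?uC ?vD.
Qed.

Lemma dominated_div (W : normedModType R) T (A : set T) (h a : T -> R) (u : T -> W) :
  (forall s, A s -> 0 < h s) ->
  dominated_on A (fun s => h s * a s) (fun s => h s *: u s) -> dominated_on A a u.
Proof.
move=> h0 [C C0 uC]; exists C => // s As; have hs := h0 s As.
by rewrite -(ler_pM2l hs) mulrCA; have := uC s As; rewrite normrZ (gtr0_norm hs).
Qed.

Lemma lie_flowE x s : P x s = x + \sum_(i < d) s ^+ i.+1 *: F i.+1 x.
Proof. by rewrite /lie_flow big_ord_recl expr0 scale1r flow_coef0. Qed.

Lemma lie_flow_quadrature x dt m : (m <= M)%N ->
  P x (c m * dt) = x + dt *: \sum_(r < d) w r m *: P' x (c r * dt).
Proof.
move=> mM; rewrite lie_flowE; congr (_ + _).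
under [in RHS]eq_bigr => r _ do rewrite /lie_flow' scaler_sumr.
rewrite exchange_big scaler_sumr; apply: eq_bigr => i _.
have iM : (i <= M)%N by rewrite -ltnS.
rewrite exprMn -(quad_weight_exact hc iM mM) mulr_suml scaler_suml scaler_sumr.
apply: eq_bigr => r _; rewrite !scalerA; congr (_ *: _).
by rewrite exprMn exprS; ring.
Qed.

(* A state is a step size, the value at the beginning of the step and the
   correction iterates; h^k-estimates are made uniform over such states. *)
Definition admissible rho : set S := [set s |
  [/\ 0 < s.1.1 <= 1, `|s.1.2| <= rho, corrections M c f s.1.1 s.1.2 s.2,
      forall k m, (k <= M)%N -> (m <= M)%N -> `|s.2 k m| <= rho + 1 &
      forall t, 0 <= t <= s.1.1 -> `|P s.1.2 t| <= rho + 1]].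

Lemma small_step_admissible rho : 0 <= rho -> exists2 h : R, 0 < h <= 1 &
  forall s : S, 0 < s.1.1 <= h -> `|s.1.2| <= rho ->
    corrections M c f s.1.1 s.1.2 s.2 -> admissible rho s.
Proof.
move=> rho0.
have [B B0 fB] := continuous_bounded_ball (rho + 1) (class_C_le (leq0n _) cf).
have [D D0 pD] := lie_flow_displacement cf rho.
pose W := \sum_(r < d) \sum_(m < d) `|w r m|.
have W0 : 0 <= W by apply: sumr_ge0 => r _; apply: sumr_ge0.
have WB0 : 0 <= W * B by exact: mulr_ge0.
(* dt * W * B <= 1 keeps every iterate within distance 1 of x, dt * D <= 1 does the same for P, and
   the summand 1 ensures h <= 1. *)
pose h := (W * B + D + 1)^-1.
have h0 : 0 < h by rewrite invr_gt0; lra.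
have h1 : h <= 1 by rewrite invf_le1; lra.
have hWB : h * (W * B) <= 1.
  by rewrite mulrC ler_pdivrMr ?mul1r//; lra.
have hD : h * D <= 1 by rewrite mulrC ler_pdivrMr ?mul1r//; lra.
exists h; first by rewrite h0.
move=> [[dt x] Y] /= /andP[dt0 dth] xr cY; split=> //=; first by rewrite dt0 (le_trans dth).
- have [Y0 Y0m Yk] := cY.
  elim=> [|k IH] m kM mM; first by rewrite Y0m// (le_trans xr)// lerDl.
  rewrite Yk// (le_trans (ler_normD _ _))// lerD// normrZ (gtr0_norm dt0).
  apply: (le_trans _ hWB); apply: ler_pM => //; first exact: ltW.
  rewrite (le_trans (ler_norm_sum _ _ _))// mulr_suml ler_sum// => r _.
  have rM : (r <= M)%N by rewrite -ltnS.
  rewrite normrZ ler_pM//; last by apply/fB/IH => //; exact: ltnW.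
  have m_lt : (m < d)%N by rewrite ltnS.
  by rewrite (bigD1 (Ordinal m_lt))//= lerDl sumr_ge0.
- move=> t /andP[t0 tdt]; rewrite -[P x t](subrK x) addrC.
  rewrite (le_trans (ler_normD _ _))// lerD//.
  have := pD (x, t); rewrite /= t0 xr => /(_ _)/le_trans; apply.
    by split=> //; rewrite (le_trans tdt)// (le_trans dth).
  by apply: (le_trans _ hD); rewrite mulrC ler_wpM2r// (le_trans tdt).
Qed.

Variable rho : R.
Local Notation G := (admissible rho).

Lemma step_ge0 k s : G s -> 0 <= s.1.1 ^+ k.
Proof. by move=> [/andP[/ltW s0 _] _ _ _ _]; exact: exprn_ge0. Qed.

Lemma step_pow_le j k s : (j <= k)%N -> G s -> s.1.1 ^+ k <= s.1.1 ^+ j.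
Proof. by move=> jk [/andP[/ltW s0 s1] _ _ _ _]; exact: ler_wiXn2l. Qed.

Lemma node_in s m : (m <= M)%N -> G s -> 0 <= c m * s.1.1 <= s.1.1.
Proof.
move=> mM [/andP[s0 s1] _ _ _ _]; have /andP[c0 c1] := subtimestep_ge0 hc mM.
by rewrite mulr_ge0 ?(ltW s0)//= ler_piMl// ltW.
Qed.

Lemma dominated_pow (W : normedModType R) (u : S -> W) j k (A : set S) :
  A `<=` G -> (j <= k)%N -> dominated_on A (fun s => s.1.1 ^+ k) u ->
  dominated_on A (fun s => s.1.1 ^+ j) u.
Proof.
move=> AG jk; apply: (@dominated_weaken _ _ _ A A _ _ _ 1) => // s As.
by rewrite mul1r step_pow_le//; exact: AG.
Qed.

Lemma dominated_powM (W : normedModType R) (u : S -> W) j k (A : set S) :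
  dominated_on A (fun s => s.1.1 ^+ j * s.1.1 ^+ k) u ->
  dominated_on A (fun s => s.1.1 ^+ (j + k)) u.
Proof. by apply: (@dominated_weaken _ _ _ A A _ _ _ 1) => // s _; rewrite mul1r -exprD. Qed.

Lemma dominated_node (W : normedModType R) (u : V * R -> W) m k (B : set (V * R)) :
  (m <= M)%N ->
  (forall s, G s -> B (s.1.2, c m * s.1.1)) ->
  dominated_on B (fun p => p.2 ^+ k) u ->
  dominated_on G (fun s => s.1.1 ^+ k) (fun s => u (s.1.2, c m * s.1.1)).
Proof.
move=> mM GB Ou.
apply: (@dominated_weaken _ _ _ G G _ (fun s => (c m * s.1.1) ^+ k) _ 1) => //.
  move=> s Gs; rewrite mul1r; have /andP[s0 s1] := node_in mM Gs.
  by apply: lerXn2r; rewrite ?nnegrE// (le_trans s0).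
exact: (dominated_comp (phi := fun s : S => (s.1.2, c m * s.1.1)) GB Ou).
Qed.

Lemma lie_flow_node k m : (k <= d.+1)%N -> (m <= M)%N ->
  dominated_on G (fun s => s.1.1 ^+ k)
    (fun s => P s.1.2 (c m * s.1.1) - \sum_(i < k) (c m * s.1.1) ^+ i *: F i s.1.2).
Proof.
move=> kd mM.
apply: (@dominated_node _ (fun p => P p.1 p.2 - \sum_(i < k) p.2 ^+ i *: F i p.1) m k _) => //;
  last exact: lie_flow_remainder kd.
move=> s Gs; have /andP[c0 c1] := node_in mM Gs; have [/andP[s0 s1] xr _ _ _] := Gs.
by split=> //=; rewrite c0 (le_trans c1).
Qed.

Lemma stage_slope_error k r : (k <= M)%N -> (r <= M)%N ->
  dominated_on G (fun s => s.1.1 ^+ k.+1) (fun s => s.2 k r - P s.1.2 (c r * s.1.1)) ->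
  dominated_on G (fun s => s.1.1 ^+ k.+1)
    (fun s => f (s.2 k r) - P' s.1.2 (c r * s.1.1)).
Proof.
move=> kM rM Ou.
apply: (@eq_dominated _ _ _ _ _ (fun s : S => (f (s.2 k r) - f (P s.1.2 (c r * s.1.1))) -
   (P' s.1.2 (c r * s.1.1) - f (P s.1.2 (c r * s.1.1))))).
  by move=> s _; rewrite opprB addrA subrK.
apply: dominatedB.
  (* The flow coefficient of index 1 is f, so this is its Lipschitz bound on the ball. *)
  have [L L0 fL] := flow_coef_lipschitz cf (rho + 1) (isT : (1 <= d)%N).
  have [C C0 uC] := Ou.
  exists (L * C) => [|s Gs]; first exact: mulr_ge0.
  have [_ _ _ Yr Pr] := Gs.
  have := fL (s.2 k r, P s.1.2 (c r * s.1.1)); rewrite /= !flow_coef1 => /(_ _)/le_trans; apply.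
    by split; [exact: Yr|apply: Pr; exact: node_in].
  by rewrite -mulrA ler_wpM2l// uC.
apply: (@dominated_pow _ _ k.+1 d) => //.
apply: (@dominated_node _ (fun p => P' p.1 p.2 - f (P p.1 p.2)) r d _) => //;
  last exact: (lie_flow_defect cf rho (rho + 1)).
move=> s Gs; have /andP[c0 c1] := node_in rM Gs; have [/andP[s0 s1] xr _ _ Pr] := Gs.
split=> //=; first by rewrite c0 (le_trans c1).
by move=> t /andP[t0 tc]; apply: Pr; rewrite t0 (le_trans tc).
Qed.

(** P - x is exactly dt times the weighted sum of values of P', so only slope errors remain, and the
    factor dt in front raises the order by one. It serves both the next correction and, with k = m =
    M, the increment. *)
Lemma weighted_slopes_error k m : (k <= M)%N -> (m <= M)%N ->
  (forall r, (r <= M)%N -> dominated_on G (fun s => s.1.1 ^+ k.+1)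
     (fun s => s.2 k r - P s.1.2 (c r * s.1.1))) ->
  dominated_on G (fun s => s.1.1 ^+ k.+2)
    (fun s => s.1.1 *: (\sum_(r < d) w r m *: f (s.2 k r)) -
              (P s.1.2 (c m * s.1.1) - s.1.2)).
Proof.
move=> kM mM Ou.
apply: (@eq_dominated _ _ _ _ _ (fun s : S => s.1.1 *: \sum_(r < d)
    w r m *: (f (s.2 k r) - P' s.1.2 (c r * s.1.1)))).
  move=> s Gs; rewrite lie_flow_quadrature// addrAC subrr add0r -scalerBr -sumrB.
  by congr (_ *: _); apply: eq_bigr => r _; rewrite scalerBr.
apply: (@dominated_weaken _ _ _ G G _ (fun s => s.1.1 * s.1.1 ^+ k.+1) _ 1) => //.
  by move=> s _; rewrite mul1r -exprS.
apply: dominatedZ.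
  by exists 1 => // s [/andP[s0 _] _ _ _ _]; rewrite mul1r gtr0_norm.
apply: dominated_sum => [s|r]; first exact: step_ge0.
have rM : (r <= M)%N by rewrite -ltnS.
by apply: dominated_cstZ; apply: stage_slope_error => //; exact: Ou.
Qed.

Lemma stage_error k m : (k <= M)%N -> (m <= M)%N ->
  dominated_on G (fun s => s.1.1 ^+ k.+1) (fun s => s.2 k m - P s.1.2 (c m * s.1.1)).
Proof.
elim: k m => [|k IH] m kM mM.
  have := @lie_flow_node 1 m isT mM => /dominatedN; apply: eq_dominated => s Gs.
  have [_ _ [_ -> //] _ _] := Gs.
  by rewrite big_ord1 expr0 scale1r flow_coef0 opprB.
have := @weighted_slopes_error k m (ltnW kM) mM (fun r rM => IH r (ltnW kM) rM).
apply: eq_dominated => s Gs; have [_ _ [_ _ Yk] _ _] := Gs.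
by rewrite Yk// opprB addrCA addrA.
Qed.

Lemma increment_error :
  dominated_on G (fun s => s.1.1 ^+ M.+2)
    (fun s => s.1.1 *: increment M c f s.2 - (P s.1.2 s.1.1 - s.1.2)).
Proof.
have := @weighted_slopes_error M M (leqnn _) (leqnn _) (fun r rM => @stage_error M r (leqnn _) rM).
by have [_ c1 _] := hc; apply: eq_dominated => s _; rewrite c1 mul1r.
Qed.

Lemma displacement_dominated m : (m <= M)%N ->
  dominated_on G (fun s => s.1.1 ^+ 1) (fun s => P s.1.2 (c m * s.1.1) - s.1.2).
Proof.
move=> mM; have := @lie_flow_node 1 m isT mM; apply: eq_dominated => s _.
by rewrite big_ord1 expr0 scale1r flow_coef0.
Qed.

Lemma displacement2_dominated :
  dominated_on G (fun s => s.1.1 ^+ 2) (fun s => P s.1.2 s.1.1 - s.1.2 - s.1.1 *: f s.1.2).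
Proof.
have [_ c1 _] := hc.
have := @lie_flow_node 2 M isT (leqnn M); apply: eq_dominated => s _.
rewrite c1 mul1r big_ord_recl big_ord1 expr0 scale1r expr1 flow_coef0 flow_coef1.
by rewrite opprD addrA.
Qed.

Lemma stage_slope_bounded k r : (k <= M)%N -> (r <= M)%N ->
  dominated_on G (fun s => s.1.1 ^+ 0) (fun s => f (s.2 k r)).
Proof.
move=> kM rM.
have [B B0 fB] := continuous_bounded_ball (rho + 1) (class_C_le (leq0n _) cf).
by exists B => // s [_ _ _ Yr _]; rewrite mulr1; apply: fB; exact: Yr.
Qed.

Lemma increment_slope :
  dominated_on G (fun s => s.1.1 ^+ 1) (fun s => increment M c f s.2 - f s.1.2).
Proof.
apply: (@dominated_div _ _ _ (fun s => s.1.1)); first by move=> s [/andP[]].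
apply: (@dominated_weaken _ _ _ G G _ (fun s => s.1.1 ^+ 2) _ 1) => //.
  by move=> s _; rewrite mul1r expr2 expr1.
have := dominatedD (@dominated_pow _ _ 2 M.+2 _ (fun s => id) isT increment_error)
  displacement2_dominated.
by apply: eq_dominated => s _; rewrite addrA subrK scalerBr.
Qed.

(* Symmetrizing the double sum replaces the weight 2 (i + 1) coming from
   d/ds |P - x|^2 by i + j + 2, for which the monomials of degree at most M are
   integrated exactly. *)
Lemma flow_energy :
  dominated_on G (fun s => s.1.1 ^+ M.+2)
    (fun s => dot (P s.1.2 s.1.1 - s.1.2) (P s.1.2 s.1.1 - s.1.2) -
      2 * (s.1.1 * \sum_(r < d) w r M *
        dot (P' s.1.2 (c r * s.1.1)) (P s.1.2 (c r * s.1.1) - s.1.2))).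
Proof.
pose q k := \sum_(r < d) w r M * c r ^+ k.
apply: (@eq_dominated _ _ _ _ _ (fun s : S => \sum_(i < d) \sum_(j < d)
    (1 - (i + j).+2%:R * q (i + j).+1) *:
      (s.1.1 ^+ (i + j).+2 *: dot (F i.+1 s.1.2) (F j.+1 s.1.2)))).
  move=> [[h x] Y] _ /=; pose a i j := dot (F i.+1 x) (F j.+1 x).
  have asym i j : a i j = a j i by exact: dotC.
  have pE t : P x t - x = \sum_(i < d) t ^+ i.+1 *: F i.+1 x.
    by rewrite lie_flowE addrAC subrr add0r.
  pose b i j := q (i + j).+1 * (h ^+ (i + j).+2 * a i j).
  have -> : 2 * (h * \sum_(r < d) w r M * dot (P' x (c r * h)) (P x (c r * h) - x)) =
      \sum_(i < d) \sum_(j < d) 2 * i.+1%:R * b i j.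
    transitivity (\sum_(r < d) \sum_(i < d) \sum_(j < d)
        2 * i.+1%:R * (w r M * c r ^+ (i + j).+1 * (h ^+ (i + j).+2 * a i j))).
      rewrite !mulr_sumr; apply: eq_bigr => r _.
      rewrite pE /lie_flow' dot_suml !mulr_sumr; apply: eq_bigr => i _.
      rewrite dot_sumr !mulr_sumr; apply: eq_bigr => j _.
      by rewrite dotZl dotZr -/(a i j) !exprMn !exprS !exprD; ring.
    rewrite exchange_big; apply: eq_bigr => i _.
    rewrite exchange_big; apply: eq_bigr => j _.
    by rewrite /b /q mulr_suml mulr_sumr.
  have bsym i j : b i j = b j i by rewrite /b addnC asym.
  have -> : \sum_(i < d) \sum_(j < d) 2 * i.+1%:R * b i j =
      \sum_(i < d) \sum_(j < d) (i + j).+2%:R * b i j.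
    transitivity (\sum_(i < d) \sum_(j < d) i.+1%:R * b i j +
                  \sum_(i < d) \sum_(j < d) j.+1%:R * b i j).
      rewrite [X in _ + X]exchange_big -big_split; apply: eq_bigr => i _.
      rewrite -big_split; apply: eq_bigr => j _ /=.
      by rewrite (bsym j i); ring.
    rewrite -big_split; apply: eq_bigr => i _; rewrite -big_split; apply: eq_bigr => j _.
    by rewrite /= -mulrDl -natrD addSn addnS.
  rewrite pE dot_suml -sumrB; apply: eq_bigr => i _.
  rewrite dot_sumr -sumrB; apply: eq_bigr => j _.
  rewrite dotZl dotZr /b -/(a i j) !scale_regular !exprS !exprD; ring.
apply: dominated_sum => [s|i]; first exact: step_ge0.
apply: dominated_sum => [s|j]; first exact: step_ge0.
(* Either the quadrature integrates the monomial exactly and the coefficient vanishes, or the power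
   of dt is already at least M + 2. *)
have [ijM|Mij] := leqP (i + j).+1 M.
  apply: (@eq_dominated _ _ _ _ _ (fun=> 0)); last by apply: dominated0 => s; exact: step_ge0.
  move=> s _; have := quad_weight_exact hc ijM (leqnn M).
  have [_ c1 _] := hc; rewrite c1 expr1n => qE.
  rewrite (_ : _ * q _ = 1) ?subrr ?scale0r// -[RHS]qE /q mulr_sumr.
  by apply: eq_bigr => r _; rewrite mulrCA.
apply: (@dominated_cstZ _ _ R^o).
apply: (@dominated_pow _ _ _ (i + j).+2) => //.
apply: (@dominated_weaken _ _ _ G G _ (fun s => s.1.1 ^+ (i + j).+2 * (1 * 1)) _ 1) => //.
  by move=> s _; rewrite !mul1r mulr1.
apply: (@dominatedZ _ _ R^o).
  by exists 1 => // s Gs; rewrite mul1r ger0_norm// step_ge0.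
have FB k : (k <= d)%N -> dominated_on G (fun=> 1) (fun s => F k s.1.2).
  move=> kd; apply: (@dominated_comp _ _ _ _ [set x | `|x| <= rho] G (fun=> 1) (F k)
    (fun s : S => s.1.2)); first by move=> s [].
  exact: flow_coef_bounded cf _ _ _.
by apply: dominated_dot; apply: FB.
Qed.

(** After multiplication by dt^2, both terms are compared with their analogues on P: [e1] is the
    error made on |P - x|^2, [e2] the one made on the quadrature of the inner product of P' and P -
    x. The difference of the two analogues is [flow_energy]. *)
Lemma relaxation_defect :
  dominated_on G (fun s => s.1.1 ^+ M)
    (fun s => work dot M c f s.1.1 s.1.2 s.2 -
      dot (increment M c f s.2) (increment M c f s.2)).
Proof.
apply: (@dominated_div _ _ _ (fun s => s.1.1 ^+ 2)).
  by move=> s [/andP[s0 _] _ _ _ _]; exact: exprn_gt0.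
apply: (@dominated_weaken _ _ _ G G _ (fun s => s.1.1 ^+ M.+2) _ 1) => //.
  by move=> s _; rewrite mul1r -exprD.
pose p (s : S) : V := P s.1.2 s.1.1 - s.1.2.
pose u (s : S) : V := s.1.1 *: increment M c f s.2.
have Ou : dominated_on G (fun s => s.1.1 ^+ M.+2) (fun s => u s - p s) := increment_error.
have Op : dominated_on G (fun s => s.1.1 ^+ 0) p.
  have [_ c1 _] := hc; have := displacement_dominated (leqnn M).
  move=> /(@dominated_pow _ _ 0 1 _ (fun s => id) isT); apply: eq_dominated => s _.
  by rewrite c1 mul1r.
have Ou0 : dominated_on G (fun s => s.1.1 ^+ 0) u.
  have := dominatedD (@dominated_pow _ _ 0 _ _ (fun s => id) isT Ou) Op.
  by apply: eq_dominated => s _; rewrite subrK.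
pose e1 (s : S) : R := dot (u s) (u s - p s) + dot (u s - p s) (p s).
have Oe1 : dominated_on G (fun s => s.1.1 ^+ M.+2) e1.
  apply: dominatedD.
    by apply: (@dominated_powM _ _ 0 M.+2); exact: dominated_dot.
  by have := dominated_powM (dominated_dot Ou Op); rewrite addn0.
pose e2 (s : S) : R := \sum_(r < d) w r M *: (dot (f (s.2 M r)) (s.2 M r - P s.1.2 (c r * s.1.1)) +
  dot (f (s.2 M r) - P' s.1.2 (c r * s.1.1)) (P s.1.2 (c r * s.1.1) - s.1.2)).
have Oe2 : dominated_on G (fun s => s.1.1 ^+ M.+1) e2.
  apply: dominated_sum => [s|r]; first exact: step_ge0.
  have rM : (r <= M)%N by rewrite -ltnS.
  apply: (@dominated_cstZ _ _ R^o); apply: dominatedD.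
    apply: (@dominated_powM _ _ 0 M.+1).
    by apply: dominated_dot; [exact: stage_slope_bounded|exact: stage_error].
  apply: (@dominated_pow _ _ M.+1 (M.+1 + 1)); [by []|exact: leq_addr|].
  apply: dominated_powM; apply: dominated_dot; last exact: displacement_dominated.
  by apply: stage_slope_error => //; exact: stage_error.
have Ohe2 : dominated_on G (fun s => s.1.1 ^+ M.+2) (fun s => s.1.1 *: e2 s).
  apply: (@dominated_powM _ _ 1 M.+1); apply: (@dominatedZ _ _ R^o) => //.
  by exists 1 => // s [/andP[s0 _] _ _ _ _]; rewrite mul1r expr1 gtr0_norm.
have := dominatedB (@dominated_cstZ _ _ R^o _ _ 2 _ Ohe2) (dominatedD Oe1 flow_energy).
apply: eq_dominated => s [/andP[s0 _] _ _ _ _].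
rewrite /= !scale_regular /e1 /work mulrBr.
have -> : s.1.1 ^+ 2 * dot (increment M c f s.2) (increment M c f s.2) = dot (u s) (u s).
  by rewrite /u dotZl dotZr; ring.
have -> : e2 s = \sum_(r < d) w r M * dot (f (s.2 M r)) (s.2 M r - s.1.2) -
   \sum_(r < d) w r M * dot (P' s.1.2 (c r * s.1.1)) (P s.1.2 (c r * s.1.1) - s.1.2).
  rewrite -sumrB; apply: eq_bigr => r _; rewrite scale_regular -mulrBr; congr (_ * _).
  by rewrite !dotBl !dotBr; ring.
have -> : s.1.1 ^+ 2 * (2 * \sum_(r < d) w r M * (s.1.1^-1 * dot (f (s.2 M r)) (s.2 M r - s.1.2))) =
   2 * (s.1.1 * \sum_(r < d) w r M * dot (f (s.2 M r)) (s.2 M r - s.1.2)).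
  rewrite !mulr_sumr; apply: eq_bigr => r _.
  by field; rewrite gt_eqF.
rewrite -/(p s) !dotBl !dotBr; ring.
Qed.

Lemma increment_energy :
  dominated_on G (fun s => s.1.1 ^+ 1)
    (fun s => dot (increment M c f s.2) (increment M c f s.2) - dot (f s.1.2) (f s.1.2)).
Proof.
have Of : dominated_on G (fun s => s.1.1 ^+ 0) (fun s => f s.1.2).
  have := @stage_slope_bounded 0 0 isT isT; apply: eq_dominated => s.
  by move=> [_ _ [Y0 _ _] _ _]; rewrite Y0.
have Oi : dominated_on G (fun s => s.1.1 ^+ 0) (fun s => increment M c f s.2).
  have := dominatedD (@dominated_pow _ _ 0 1 _ (fun s => id) isT increment_slope) Of.
  by apply: eq_dominated => s _; rewrite subrK.
have := dominatedD (dominated_powM (dominated_dot increment_slope Oi))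
  (dominated_powM (dominated_dot Of increment_slope)).
by apply: eq_dominated => s _; rewrite dotBl dotBr addrA subrK.
Qed.

Definition relax (s : S) : R := relaxation dot M c f s.1.1 s.1.2 s.2.

Definition energetic mu : set S := [set s | G s /\
  mu <= dot (increment M c f s.2) (increment M c f s.2)].

Lemma relaxation_error mu : 0 < mu ->
  dominated_on (energetic mu) (fun s => s.1.1 ^+ M) (fun s => relax s - 1).
Proof.
move=> mu0; have [C C0 eC] := relaxation_defect.
exists (C / mu) => [|s [Gs]]; first by rewrite divr_ge0// ltW.
set D := dot _ _ => muD; have D0 : 0 < D by exact: lt_le_trans muD.
rewrite /relax /relaxation -/D gt_eqF//=.
rewrite -[X in _ / D - X](divff (lt0r_neq0 D0)) -mulrBl normrM normfV (gtr0_norm D0).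
rewrite ler_pdivrMr// (le_trans (eC s Gs))//.
rewrite (_ : C / mu * s.1.1 ^+ M * D = C * s.1.1 ^+ M * (D / mu)); last by ring.
by rewrite ler_peMr ?mulr_ge0 ?step_ge0// ler_pdivlMr// mul1r.
Qed.

Lemma relaxed_step_error mu : 0 < mu ->
  dominated_on [set s | energetic mu s /\ `|relax s - 1| <= 1] (fun s => s.1.1 ^+ M.+2)
    (fun s => s.1.2 + (relax s * s.1.1) *: increment M c f s.2 - P s.1.2 (relax s * s.1.1)).
Proof.
move=> mu0; set A := [set s | _].
have AE : A `<=` energetic mu by move=> s [].
have AG : A `<=` G by move=> s [] [].
have Or : dominated_on A (fun s => s.1.1 ^+ M) (fun s => relax s - 1).
  by have [C C0 rC] := relaxation_error mu0; exists C => // s /AE; exact: rC.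
have restr (W : normedModType R) k (u : S -> W) : dominated_on G (fun s => s.1.1 ^+ k) u ->
    dominated_on A (fun s => s.1.1 ^+ k) u.
  by move=> [C C0 uC]; exists C => // s /AG; exact: uC.
have Odt : dominated_on A (fun s => s.1.1 ^+ 1) (fun s => s.1.1).
  by exists 1 => // s /AG [/andP[s0 _] _ _ _ _]; rewrite mul1r expr1 gtr0_norm.
(* (gamma - 1) dt f(x) is subtracted from both the extra increment and the extra flow. Each
   difference is O((gamma - 1) dt^2), which makes up for gamma - 1 being only O(dt^M). *)
have O1 : dominated_on A (fun s => s.1.1 ^+ M.+2)
    (fun s => (relax s - 1) *: (s.1.1 *: (increment M c f s.2 - f s.1.2))).
  rewrite -addn2; apply: dominated_powM; apply: dominatedZ => //.
  by apply: (@dominated_powM _ _ 1 1); apply: dominatedZ => //; exact: restr increment_slope.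
have O2 : dominated_on A (fun s => s.1.1 ^+ M.+2)
    (fun s => P s.1.2 (relax s * s.1.1) - P s.1.2 s.1.1 -
       ((relax s - 1) * s.1.1) *: f s.1.2).
  rewrite -addn2; apply: dominated_powM.
  have [C C0 rC] := lie_flow_rescale cf isT rho.
  have [D D0 rD] := Or.
  exists (C * D) => [|s As]; first exact: mulr_ge0.
  have [/andP[s0 s1] xr _ _ _] := AG s As.
  have := rC (s.1.2, s.1.1, relax s); rewrite /= => /(_ _)/le_trans; apply.
    by split=> //; [rewrite (ltW s0)|case: As].
  by rewrite -mulrA ler_wpM2l// mulrA ler_wpM2r// ?exprn_ge0 ?(ltW s0)// rD.
have := dominatedB (dominatedD (restr _ _ _ increment_error) O1) O2.
apply: eq_dominated => s _.
by apply/rowP => m; rewrite !mxE; ring.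
Qed.

End LocalError.

Section Consistency.
Context {R : realType} {n : nat}.
Local Notation V := 'rV[R]_n.
Variables (dot : {dot V for idfun}) (M : nat) (c : nat -> R) (f : V -> V).
Hypothesis hc : subtimestep_positions M c.
Hypothesis M0 : (0 < M)%N.
Hypothesis cf : of_class_C M.+1 f.

(** Trades the lower bound on D, which involves the iterates, for one on x alone: D differs from
    |f(x)|^2 by O(dt), so 2 * mu leaves D >= mu for small dt. *)
Lemma rdec_consistency rho mu : 0 <= rho -> 0 < mu ->
  exists C h : R, [/\ 0 <= C, 0 < h <= 1 &
    forall dt x Y, 0 < dt <= h -> `|x| <= rho -> corrections M c f dt x Y ->
      2 * mu <= dot (f x) (f x) -> let g := relaxation dot M c f dt x Y in
      `|g - 1| <= 1 / 2 /\
      `|x + (g * dt) *: increment M c f Y - lie_flow f M.+1 x (g * dt)| <= C * dt ^+ M.+2].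
Proof.
move=> rho0 mu0.
have [h1 /andP[h10 h11] adm] := small_step_admissible c cf rho0.
have [h2 h20 eh2] := dominated_lt mu0 (increment_energy dot hc cf rho).
have half0 : (0 : R) < 1 / 2 by rewrite divr_gt0.
have [h3 h30 eh3] := dominated_lt half0 (relaxation_error dot hc cf rho mu0).
have [C C0 eC] := relaxed_step_error dot hc cf rho mu0.
exists C, (Num.min h1 (Num.min h2 h3)); split=> //.
  by rewrite !lt_min h10 h20 h30 ge_min h11.
move=> dt x Y /andP[dt0]; rewrite !le_min => /and3P[dt1 dt2 dt3] xr cY fx /=.
have As : admissible M c f rho (dt, x, Y) by apply: adm => //=; rewrite dt0.
have Es : energetic dot M c f rho mu (dt, x, Y).
  split=> //=; have := eh2 _ As; rewrite /= expr1 => /(_ dt2); rewrite ler_norml; lra.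
(* The smallness of gamma - 1 comes from M >= 1, that is d > 1. *)
have dtM : dt ^+ M <= h3.
  by rewrite (le_trans _ dt3)// -[leRHS]expr1 ler_wiXn2l ?(ltW dt0)// (le_trans dt1).
have g1 := eh3 _ Es dtM; split=> //.
have := eC (dt, x, Y); apply; split=> //=.
by rewrite (le_trans g1)// ler_pdivrMr// mul1r ler1n.
Qed.

End Consistency.


(** * Convergence *)

Section SolutionBounds.
Context {R : realType} {n : nat}.
Local Notation V := 'rV[R]_n.

(** Two-sided Gronwall by integrating factors: v exp(-k t) is nonincreasing and v exp(k t)
    nondecreasing. The backward direction is needed because an equilibrium could first be detected
    at a late time t1. *)
Lemma vanishing_differential_inequality (v v' : R -> R) (a b k t1 : R) :
  {within `[a, b], continuous v} ->
  (forall t, a < t < b -> is_derive t (1 : R) v (v' t)) ->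
  (forall t, a < t < b -> `|v' t| <= k * v t) ->
  a <= t1 <= b -> v t1 = 0 -> forall t, a <= t <= b -> v t <= 0.
Proof.
move=> cv dv vk t1ab vt1 t tab.
pose E (l : R) (s : R) : R := expR (l * s).
have dE l s : is_derive s (1 : R) (E l) (l * E l s).
  rewrite /E; apply: is_derive_eq; rewrite mulrC.
  by rewrite scaler1.
have cE l : continuous (E l).
  by move=> s; apply: differentiable_continuous; apply/derivable1_diffP; have [] := dE l s.
have cvE l : {within `[a, b], continuous (v * E l)}.
  by move=> s; apply: continuousM; [exact: cv|exact: (continuous_subspaceT (@cE l))].
have dvE l s : a < s < b -> is_derive s (1 : R) (v * E l) ((v' s + l * v s) * E l s).
  move=> sab; apply: (is_derive_eq (is_deriveM (dv s sab) (dE l s))).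
  by rewrite !scale_regular; ring.
have ab (s : R) : (s \in `]a, b[) = (a < s < b) by rewrite in_itv.
have abc (s : R) : (s \in `[a, b]) = (a <= s <= b) by rewrite in_itv.
have E0 l s : 0 < E l s by exact: expR_gt0.
have [t1t|tt1] := leP t1 t.
  have : (v * E (- k)) t <= (v * E (- k)) t1.
    apply: (ler0_derive1_le_cc _ _ (cvE _)); rewrite ?abc//.
    - by move=> s; rewrite ab => /(dvE (- k)) [].
    - move=> s; rewrite ab => sab; have ds := dvE (- k) s sab.
      rewrite derive1E derive_val; have := vk s sab; rewrite ler_norml => /andP[_ h].
      by rewrite pmulr_lle0//; lra.
  by rewrite !fctE vt1 mul0r pmulr_lle0.
have : (v * E k) t <= (v * E k) t1.
  apply: (ger0_derive1_le_cc _ _ (cvE _)); rewrite ?abc ?(ltW tt1)//.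
  - by move=> s; rewrite ab => /(dvE k) [].
  - move=> s; rewrite ab => sab; have ds := dvE k s sab.
    rewrite derive1E derive_val; have := vk s sab; rewrite ler_norml => /andP[h _].
    by rewrite pmulr_lge0//; lra.
by rewrite !fctE vt1 mul0r pmulr_lle0.
Qed.

Variables (f : V -> V) (t0 T : R) (y0 : V) (y : R -> V).
Hypothesis cf : of_class_C 1 f.
Hypothesis t0T : t0 < T.
Hypothesis hy : ode_solution f t0 T y0 y.

Lemma solution_bounded : exists2 rho : R, 0 <= rho & forall t, t0 <= t <= T -> `|y t| <= rho.
Proof.
have [_ cy _] := hy.
have [B [_ yB]] : bounded_set (y @` `[t0, T]).
  by apply/compact_bounded/continuous_compact => //; exact: segment_compact.
exists (Num.max 0 (B + 1)); first by rewrite le_max lexx.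
move=> t tT; rewrite le_max (yB (B + 1)) ?orbT ?ltrDl //; by exists t.
Qed.

Lemma solution_equilibrium t1 : t0 <= t1 <= T -> f (y t1) = 0 ->
  forall t, t0 <= t <= T -> y t = y t1.
Proof.
move=> t1T ft1 t tT; have [rho rho0 yr] := solution_bounded.
have [L L0 fL] := flow_coef_lipschitz cf rho (isT : (1 <= 1)%N).
have [_ cy dy] := hy.
pose u i s := y s 0 i - y t1 0 i.
(* The norm of row vectors is a maximum and not differentiable, hence the Euclidean square. As f
   vanishes at y t1, the Lipschitz bound gives |f(y)| <= L sqrt(v), and so |v'| <= 2 L n v. *)
pose v := \sum_(i < n) (u i * u i).
pose v' s := \sum_(i < n) (u i s * f (y s) 0 i + u i s * f (y s) 0 i).
have dyi s i : t0 < s < T -> is_derive s (1 : R) (u i) (f (y s) 0 i).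
  move=> sT; have dys := dy s sT.
  have dc : differentiable (@coordinate R n i) (y s).
    by apply: linear_differentiable; exact: coord_continuous.
  have := is_deriveB (is_derive_comp_curve dys dc) (is_derive_cst (y t1 0 i) s (1 : R)).
  by rewrite subr0 diff_lin//; exact: coord_continuous.
have cu i : {within `[t0, T], continuous (u i)}.
  move=> s; apply: (@continuousB _ R^o (subspace `[t0, T]) (fun s => y s 0 i)).
    apply: (@continuous_comp (subspace `[t0, T]) V R y (fun x => x 0 i)); first exact: cy.
    exact: coord_continuous.
  exact: cst_continuous.
have cv : {within `[t0, T], continuous v}.
  rewrite /v; elim/big_ind: _ => [s|a b ca cb s|i _ s]; first exact: cst_continuous.
  - by apply: continuousD; [exact: ca|exact: cb].
  - by apply: continuousM; exact: cu.
have dv s : t0 < s < T -> is_derive s (1 : R) v (v' s).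
  move=> sT; apply: is_derive_sum => i.
  by have := is_deriveM (dyi s i sT) (dyi s i sT).
have ui s i : u i s = (y s - y t1) 0 i by rewrite !mxE.
have vE s : v s = \sum_(i < n) (u i s) ^+ 2.
  by rewrite /v fct_sumE; apply: eq_bigr => i _; rewrite fctE expr2.
have v0 s : 0 <= v s by rewrite vE; apply: sumr_ge0 => i _; exact: sqr_ge0.
have uv s i : u i s ^+ 2 <= v s.
  by rewrite vE (bigD1 i)//= lerDl; apply: sumr_ge0 => j _; exact: sqr_ge0.
have nv s : `|y s - y t1| <= Num.sqrt (v s).
  apply: row_norm_le => [|i]; first exact: sqrtr_ge0.
  by rewrite -ui -sqrtr_sqr ler_sqrt// uv.
have vk s : t0 < s < T -> `|v' s| <= (2 * L * n%:R) * v s.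
  move=> sT; have sT' : t0 <= s <= T by case/andP: sT => /ltW-> /ltW->.
  rewrite (le_trans (ler_norm_sum _ _ _))//.
  apply: (@le_trans _ _ (\sum_(i < n) 2 * L * v s)); last first.
    by rewrite sumr_const card_ord -[leLHS]mulr_natr mulrAC.
  apply: ler_sum => i _.
  rewrite (_ : _ + _ = 2 * (u i s * f (y s) 0 i)); last by ring.
  rewrite normrM normr_nat -mulrA ler_wpM2l// normrM.
  have h1 : `|u i s| <= Num.sqrt (v s) by rewrite ui (le_trans (row_norm_ge _ _)).
  have h2 : `|f (y s) 0 i| <= L * Num.sqrt (v s).
    have := fL (y s, y t1); rewrite /= !flow_coef1 ft1 subr0 => h.
    rewrite (le_trans (row_norm_ge _ _))// (le_trans (h _))//; first by split; exact: yr.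
    by rewrite ler_wpM2l.
  rewrite (le_trans (ler_pM _ _ h1 h2))// mulrCA -expr2 sqr_sqrtr//.
have vt1 : v t1 = 0 by rewrite vE big1// => i _; rewrite /u subrr expr0n.
have vt := vanishing_differential_inequality cv dv vk t1T vt1 tT.
apply/eqP; rewrite -subr_eq0 -normr_le0 (le_trans (nv t))//.
by rewrite ler0_sqrtr.
Qed.

End SolutionBounds.


(** * Propagation of the local error *)

Section Convergence.
Context {R : realType} {n : nat}.
Local Notation V := 'rV[R]_n.
Variables (dot : {dot V for idfun}) (M : nat) (c : nat -> R) (f : V -> V).
Hypothesis hc : subtimestep_positions M c.
Hypothesis M0 : (0 < M)%N.
Hypothesis cf : of_class_C M.+1 f.
Variables (t0 T : R) (y0 : V) (y : R -> V).
Hypothesis t0T : t0 < T.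
Hypothesis hy : ode_solution f t0 T y0 y.
Local Notation d := M.+1.

Let cf1 : of_class_C 1 f. Proof. exact: class_C_le cf. Qed.

Lemma corrections_equilibrium dt x Y : f x = 0 -> corrections M c f dt x Y ->
  increment M c f Y = 0.
Proof.
move=> fx [_ Y0 Yk].
have YE k m : (k <= M)%N -> (m <= M)%N -> Y k m = x.
  elim: k m => [|k IH] m kM mM; first exact: Y0.
  rewrite Yk// big1 ?scaler0 ?addr0// => r _.
  by rewrite IH ?fx ?scaler0//; [exact: ltnW|rewrite -ltnS].
rewrite /increment big1// => r _.
by rewrite YE ?fx ?scaler0// -ltnS.
Qed.

Lemma equilibrium_solution dt tn (yn : nat -> V) : 0 < dt -> f y0 = 0 ->
  rdec_solution dot d c f dt t0 y0 tn yn -> forall k, t0 <= tn k /\ yn k = y0.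
Proof.
move=> dt0 fy0 [tn0 yn0 step]; elim=> [|k [tk yk]]; first by rewrite tn0.
have [Y [cY tE yE]] := rdec_step_reduced hc M0 dt0 (step k).
rewrite yk in cY tE yE; have inc0 := corrections_equilibrium fy0 cY.
(* The increment vanishes, so the default gamma = 1 applies and time still advances by dt. *)
move: tE yE; rewrite /relaxation inc0 scaler0 addr0 linear0l eqxx /= mul1r => -> ->.
by split=> //; rewrite (le_trans tk)// lerDl ltW.
Qed.

Lemma dot_norm_bounded : exists2 B : R, 0 <= B & forall v : V, dot_norm dot v <= B * `|v|.
Proof.
have [B B0 dB] := dot_bounded dot.
exists (Num.sqrt B) => [|v]; first exact: sqrtr_ge0.
rewrite /dot_norm -[leRHS]ger0_norm ?mulr_ge0 ?sqrtr_ge0// -sqrtr_sqr.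
rewrite ler_wsqrtr// exprMn sqr_sqrtr//.
by rewrite (le_trans (ler_norm _))// (le_trans (dB v v)).
Qed.

Lemma class_C_dot_slope k : of_class_C k f -> of_class_C k (fun x => dot (f x) (f x)).
Proof.
move=> ck; rewrite (_ : (fun x => _) = \sum_(i < n) \sum_(j < n)
    (fun x => f x 0 i) * ((fun x => f x 0 j) * (fun=> dot (delta_mx 0 i) (delta_mx 0 j)))).
  apply: class_C_sum => i; apply: class_C_sum => j.
  apply: class_CM; first exact: (class_C_coord i ck).
  by apply: class_CM; [exact: (class_C_coord j ck)|exact: class_C_cst].
apply/funext => x; rewrite {1}(row_sum_delta (f x)) dot_suml fct_sumE.
apply: eq_bigr => i _; rewrite {2}(row_sum_delta (f x)) dot_sumr fct_sumE.
by apply: eq_bigr => j _; rewrite dotZl dotZr.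
Qed.

Lemma slope_energy_lower_bound : (forall t, t0 <= t <= T -> f (y t) != 0) ->
  exists2 mu : R, 0 < mu & forall t, t0 <= t <= T -> mu <= dot (f (y t)) (f (y t)).
Proof.
move=> fy; have [_ cy _] := hy.
have cD : {within `[t0, T], continuous (fun t => dot (f (y t)) (f (y t)))}.
  move=> t; apply: (@continuous_comp (subspace `[t0, T]) V R y (fun x => dot (f x) (f x))).
    exact: cy.
  exact: (@class_C_dot_slope 0 (class_C_le (leq0n _) cf)).
have [t1 t1T mint] := EVT_min (ltW t0T) cD.
exists (dot (f (y t1)) (f (y t1))) => [|t tT]; last by apply: mint; rewrite in_itv.
by apply/neq0_dnorm_gt0/fy; move: t1T; rewrite in_itv.
Qed.

Lemma relaxed_step_size (g dt : R) : `|g - 1| <= 1 / 2 -> 0 < dt <= 1 / 2 ->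
  [/\ 0 <= g * dt <= 1, g * dt <= 2 * dt & dt <= 2 * (g * dt)].
Proof.
by rewrite ler_norml => /andP[g1 g2] /andP[dt0 dt2]; split; [apply/andP; split| |]; nra.
Qed.

(** Used with a = exp(2k(t - t0)) and b = exp(2ks), for a relaxed step s >= h / 2: the exponent 2k
    compensates for steps shorter than h, and k >= 1 absorbs the local error term h. *)
Lemma gronwall_step (k h a b : R) : 0 <= h -> 1 <= k -> 1 <= a -> 1 + k * h <= b ->
  (1 + k * h) * (a - 1) + h <= a * b - 1.
Proof.
move=> h0 k1 a1 hb.
have : a * (1 + k * h) <= a * b by rewrite ler_wpM2l// (le_trans ler01).
have : h <= k * h by rewrite ler_peMl.
lra.
Qed.

Lemma energy_halved (m a b x : R) : - x <= a - b -> m <= b -> x <= m / 2 ->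
  2 * (m / 4) <= a.
Proof. lra. Qed.

Lemma error_sum (p q r s z : R) : s <= z -> p + (q + s) + r <= q + z + (p + r).
Proof. lra. Qed.

(** All times up to index k are assumed to be at most T, because their monotonicity is not known
    beforehand: gamma > 0 follows only from the error bound at the previous step. *)
Lemma regular_convergence : (forall t, t0 <= t <= T -> f (y t) != 0) ->
  exists C dtmax : R, [/\ 0 <= C, 0 < dtmax & forall dt tn (yn : nat -> V),
    0 < dt <= dtmax -> rdec_solution dot d c f dt t0 y0 tn yn ->
    forall k, (forall j, (j <= k)%N -> tn j <= T) ->
      t0 <= tn k /\ `|yn k - y (tn k)| <= C * dt ^+ d].
Proof.
move=> fy; have [mu mu0 ymu] := slope_energy_lower_bound fy.
have [rho0 rho00 yr0] := solution_bounded hy.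
pose rho := rho0 + 1.
have [LD LD0 DL] := class_C1_lipschitz rho (class_C_dot_slope cf1).
have mu4 : 0 < mu / 4 by rewrite divr_gt0.
have rho_ge0 : 0 <= rho by rewrite addr_ge0.
(* With mu / 4, consistency asks for |f|^2 >= mu / 2 at the numerical value; the other half of mu is
   the margin for its distance to the exact solution. *)
have [C1 [h1 [C10 /andP[h10 h11] step1]]] := rdec_consistency dot hc M0 cf rho_ge0 mu4.
have [L L0 flowL] := lie_flow_lipschitz cf rho.
have [C2 C20 solC] := lie_flow_solution cf hy yr0.
(* Local error of the scheme against P, plus that of P against the exact solution over a relaxed
   step of length at most 2 dt. *)
pose C := C1 + C2 * 2 ^+ d.+1.
have C0 : 0 <= C by rewrite addr_ge0// mulr_ge0// exprn_ge0.
(* L s <= 2 L dt is the amplification in one step; the summand 1 provides the k >= 1 of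
   [gronwall_step]. *)
pose k0 := 2 * L + 1.
have k01 : 1 <= k0 by rewrite /k0; lra.
have k00 : 0 < k0 by exact: lt_le_trans k01.
pose E t := expR (2 * k0 * (t - t0)) - 1.
pose K := expR (2 * k0 * (T - t0)).
have K0 : 0 < K by exact: expR_gt0.
(* An error below 1 keeps the numerical value in the ball of radius rho; below the second bound it
   changes |f|^2 by at most mu / 2. *)
pose del := Num.min 1 (mu / 2 / (LD + 1)).
have del0 : 0 < del by rewrite lt_min ltr01 !divr_gt0// ltr_wpDl.
have CK0 : 0 <= C * K by rewrite mulr_ge0// ltW.
(* The bound 1 / 2 keeps relaxed steps below 1, and the last one makes the claimed error at most
   [del], which closes the circular argument. *)
pose dtmax := Num.min h1 (Num.min (1 / 2) (del / (C * K + 1))).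
have dtmax0 : 0 < dtmax by rewrite !lt_min h10 !divr_gt0// ltr_wpDl.
have EK t : t <= T -> E t <= K.
  move=> tT; apply: (@le_trans _ _ (expR (2 * k0 * (t - t0)))); first by rewrite /E; lra.
  by rewrite ler_expR ler_pM2l ?mulr_gt0// lerD2r.
exists (C * K), dtmax; split=> // dt tn yn /andP[dt0].
rewrite !le_min => /and3P[dth1 dt2 dtdel] [tn0 yn0 step].
have dtd : dt ^+ d <= dt.
  by rewrite -[leRHS]expr1 ler_wiXn2l ?(ltW dt0)//; lra.
have CKdel : C * K * dt ^+ d <= del.
  rewrite (le_trans (ler_wpM2l CK0 dtd))// (le_trans (ler_wpM2l CK0 dtdel))//.
  by rewrite mulrCA ler_piMr ?(ltW del0)// ler_pdivrMr ?mul1r ?ltr_wpDl// lerDl.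
(* The induction needs a bound depending on the time reached; the factor [E] vanishes at t0 and is
   at most K on the interval. *)
suff main k : (forall j, (j <= k)%N -> tn j <= T) ->
    t0 <= tn k /\ `|yn k - y (tn k)| <= C * dt ^+ d * E (tn k).
  move=> k tnT; have [tk ek] := main k tnT; split=> //.
  rewrite (le_trans ek)// [leRHS]mulrAC ler_wpM2l ?EK ?tnT//.
  by rewrite mulr_ge0// exprn_ge0// ltW.
elim: k => [|k IH] tnT.
  have [yt0 _ _] := hy.
  by rewrite tn0 yn0 yt0 subrr normr0 lexx /E subrr mulr0 expR0 subrr mulr0.
have [tk ek] := IH (fun j jk => tnT j (leqW jk)).
have tkT : tn k <= T by exact: tnT.
have [Y [cY tE yE]] := rdec_step_reduced hc M0 dt0 (step k).
set g := relaxation _ _ _ _ _ _ _ in tE yE.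
have yk : `|y (tn k)| <= rho0 by apply: yr0; rewrite tk.
set e := `|yn k - y (tn k)| in ek.
have e0 : 0 <= e by exact: normr_ge0.
have e_del : e <= del.
  rewrite (le_trans ek)// (le_trans _ CKdel)// [leRHS]mulrAC ler_wpM2l ?EK//.
  by rewrite mulr_ge0// exprn_ge0// ltW.
have xr : `|yn k| <= rho.
  rewrite -[yn k](subrK (y (tn k))) (le_trans (ler_normD _ _))// addrC lerD//.
  by rewrite (le_trans e_del)// ge_min lexx.
have yr : `|y (tn k)| <= rho by rewrite (le_trans yk)// lerDl.
have Dx : 2 * (mu / 4) <= dot (f (yn k)) (f (yn k)).
  have := DL _ _ xr yr; rewrite -/e ler_norml => /andP[h _].
  have ymuk : mu <= dot (f (y (tn k))) (f (y (tn k))) by apply: ymu; rewrite tk.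
  suff : LD * e <= mu / 2 by exact: energy_halved h ymuk.
  have : e <= mu / 2 / (LD + 1) by rewrite (le_trans e_del)// ge_min lexx orbT.
  rewrite ler_pdivlMr ?ltr_wpDl//; apply: le_trans.
  by rewrite mulrC ler_wpM2l// lerDl.
have [] := step1 dt (yn k) Y _ xr cY Dx; first by rewrite dt0.
rewrite -/g => g1 loc; pose s := g * dt.
have [/andP[s0 s1] s2 sdt] := relaxed_step_size g1 (introT andP (conj dt0 dt2)).
rewrite -/s in s0 s1 s2 sdt.
have tk1 : tn k.+1 = tn k + s by [].
have tk1T : tn k + s <= T by rewrite -tk1 tnT.
split; first by rewrite tk1 (le_trans tk)// lerDl.
have lip := flowL (yn k, y (tn k), s); rewrite /= in lip.
have sol := solC (tn k, s); rewrite /= in sol.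
have {}lip : `|lie_flow f d (yn k) s - lie_flow f d (y (tn k)) s| <= e + L * (s * e).
  rewrite -[X in `|X|](subrK (yn k - y (tn k))) (le_trans (ler_normD _ _))// addrC.
  by rewrite lerD2l lip//; split=> //; rewrite s0.
have {}sol : `|y (tn k + s) - lie_flow f d (y (tn k)) s| <= C2 * 2 ^+ d.+1 * dt ^+ d.+1.
  rewrite (le_trans (sol _))//; first by split=> //; rewrite s0.
  by rewrite -mulrA ler_wpM2l// -exprMn; apply: lerXn2r; rewrite ?nnegrE// (le_trans s0).
have err : `|yn k.+1 - y (tn k.+1)| <= (1 + k0 * dt) * e + C * dt ^+ d.+1.
  rewrite tk1 yE -/s.
  (* Local error of the scheme, propagation of the old error by P, and Taylor error of the exact
     solution. *)
  rewrite (_ : _ - y _ = (yn k + s *: increment M c f Y - lie_flow f d (yn k) s) +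
    (lie_flow f d (yn k) s - lie_flow f d (y (tn k)) s) -
    (y (tn k + s) - lie_flow f d (y (tn k)) s)); last first.
    by rewrite opprB !addrA !subrK.
  rewrite (le_trans (ler_normB _ _))// (le_trans (lerD (ler_normD _ _) (lexx _)))//.
  apply: (le_trans (lerD (lerD loc lip) sol)).
  have : L * (s * e) <= k0 * dt * e.
    rewrite mulrA ler_wpM2r// /k0 mulrDl mul1r -[leLHS]addr0 lerD ?(ltW dt0)//.
    by rewrite [2 * L]mulrC -mulrA ler_wpM2l.
  rewrite [X in _ -> _ <= X](_ : _ = e + k0 * dt * e +
    (C1 * dt ^+ d.+1 + C2 * 2 ^+ d.+1 * dt ^+ d.+1)); first exact: error_sum.
  by rewrite /C; ring.
apply: (le_trans err).
have A0 : 0 <= C * dt ^+ d by rewrite mulr_ge0// exprn_ge0// ltW.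
apply: (@le_trans _ _ ((1 + k0 * dt) * (C * dt ^+ d * E (tn k)) + C * dt ^+ d * dt)).
  rewrite -[X in _ <= _ + X]mulrA -exprSr lerD2r ler_wpM2l//.
  by rewrite addr_ge0// mulr_ge0// ltW.
rewrite mulrCA -mulrDr ler_wpM2l//.
have -> : E (tn k.+1) = expR (2 * k0 * (tn k - t0)) * expR (2 * k0 * s) - 1.
  by rewrite /E -expRD tk1; congr (expR _ - 1); ring.
rewrite /E; set a := expR (2 * k0 * (tn k - t0)).
have a1 : 1 <= a by rewrite -expR0 ler_expR mulr_ge0 ?mulr_ge0 ?(ltW k00)// subr_ge0.
have b1 : 1 + k0 * dt <= expR (2 * k0 * s).
  rewrite (le_trans _ (expR_ge1Dx _))// lerD2l [2 * k0]mulrC -mulrA.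
  by rewrite ler_wpM2l// ltW.
exact: gronwall_step (ltW dt0) k01 a1 b1.
Qed.

End Convergence.

Theorem theorem3p2 (R : realType) (I d : nat) (hd : (1 < d)%N)
    (dot : {dot 'rV[R]_I for idfun})
    (c : nat -> R) (hc : subtimestep_positions d.-1 c)
    (f : 'rV[R]_I -> 'rV[R]_I) (hf : of_class_C d f)
    (t0 T : R) (hT : t0 < T) (y0 : 'rV[R]_I)
    (y : R -> 'rV[R]_I) (hy : ode_solution f t0 T y0 y) :
  exists C dtmax : R, 0 < dtmax /\
    forall dt : R, 0 < dt <= dtmax ->
    forall (tn : nat -> R) (yn : nat -> 'rV[R]_I),
      rdec_solution dot d c f dt t0 y0 tn yn ->
    forall n : nat, (forall k : nat, (k <= n)%N -> tn k <= T) ->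
      dot_norm dot (yn n - y (tn n)) <= C * dt ^+ d.
Proof.
case: d hd hc hf => [//|M] M0 hc hf; have [yt0 _ _] := hy.
have cf1 : of_class_C 1 f by exact: class_C_le hf.
have [[t1 t1T ft1]|fy] := pselect (exists2 t1, t0 <= t1 <= T & f (y t1) = 0).
  have yE t : t0 <= t <= T -> y t = y0.
    move=> tT; rewrite -yt0 (solution_equilibrium cf1 hy t1T ft1 tT).
    by rewrite (solution_equilibrium cf1 hy t1T ft1)// lexx ltW.
  have fy0 : f y0 = 0 by rewrite -(yE t1).
  exists 0, 1; split=> // dt /andP[dt0 _] tn yn sol k tnT.
  have [tk yk] := equilibrium_solution hc M0 dt0 fy0 sol k.
  by rewrite yk yE ?tk ?tnT// subrr /dot_norm linear0l sqrtr0 mul0r.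
have [|C [dtmax [C0 dtmax0 conv]]] := regular_convergence dot hc M0 hf hT hy.
  by move=> t tT; apply/eqP => fyt; apply: fy; exists t.
have [B B0 dB] := dot_norm_bounded dot.
exists (B * C), dtmax; split=> // dt dtb tn yn sol k tnT.
have [_ ek] := conv dt tn yn dtb sol k tnT.
by rewrite (le_trans (dB _))// -mulrA ler_wpM2l.
Qed.
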